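(* For every finite system $\mathcal E$ of equations between $\Sigma$-terms, the procedure $\mathsf{general\_aci}$ is correct and complete with respect to the general $ACI1$ theory: every substitution read off from the solved-form system $\mathcal E_s$ of a non-failing terminating branch of $\mathsf{general\_aci}(\mathcal E)$ is an $ACI1$-unifier of $\mathcal E$, and for every $ACI1$-unifier $\sigma$ of $\mathcal E$ some such branch yields a substitution more general than $\sigma$ modulo $ACI1$ on $\mathrm{vars}(\mathcal E)$.
   Context: $\Sigma$ contains the constant $\emptyset$, the binary symbol $\cup$, and free function symbols of arbitrary arities. $=_{ACI1}$ is the least congruence closed under substitution containing $(X\cup Y)\cup Z\approx X\cup(Y\cup Z)$, $X\cup Y\approx Y\cup X$, $X\cup X\approx X$, $X\cup\emptyset\approx X$. An $ACI1$-unifier of a system is a substitution $\sigma$ with $\ell\sigma=_{ACI1}r\sigma$ for each equation $\ell=r$. $\theta$ is more general than $\sigma$ on $W$ if there is $\lambda$ with $\sigma(X)=_{ACI1}\lambda(\theta(X))$ for all $X\in W$. A solved-form system $\{X_1=t_1,\dots,X_n=t_n\}$ (each $X_i$ occurring nowhere else) yields the substitution $[X_1/t_1,\dots,X_n/t_n]$. $\mathsf{general\_aci}(\mathcal E)$: $\mathcal E_s:=\emptyset$, $\mathcal E_{ns}:=\mathcal E$; while $\mathcal E_{ns}\ne\emptyset$, remove an arbitrary equation $e$ and act by cases: (1) $X=X$: nothing. (2) $t=X$, $t$ not a variable: add $X=t$. (3) $X=t$ where $t$ can be reordered as $f_1(\bar s_1)\cup\dots\cup f_n(\bar s_n)\cup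 V_1\cup\dots\cup V_m$ ($f_i\not\equiv\cup$, $V_j$ variables) with $X\in\mathrm{vars}(\bar s_1,\dots,\bar s_n)$: fail. (4) $X=t$, $X$ not in $t$: $\mathcal E_s:=\mathcal E_s[X/t]\wedge(X=t)$, $\mathcal E_{ns}:=\mathcal E_{ns}[X/t]$. (5) $X=t$ where $t$ reorders as $t'\cup X\cup\dots\cup X$ with $t'$ as in (3) and $X\notin\mathrm{vars}(t')$: add $X=t'\cup N$, $N$ new. (6) $f(\bar s)=g(\bar t)$, $f\not\equiv g$: fail. (7) $f(s_1,\dots,s_n)=f(t_1,\dots,t_n)$, $f\not\equiv\cup$: add $s_i=t_i$. (8) $s_1\cup s_2=t_1\cup t_2$: choose a result $\langle\mathcal E'_1,\mathcal E'_2,\theta\rangle$ of $\mathsf{aci\_step}$ on it; $\mathcal E_s:=\mathcal E_s\theta\wedge\mathcal E'_1$, $\mathcal E_{ns}:=\mathcal E_{ns}\theta\wedge\mathcal E'_2$. $\mathsf{aci\_step}$ on $f_1(\bar l_1)\cup\dots\cup f_{k_1}(\bar l_{k_1})\cup L_1\cup\dots\cup L_{k_2}=g_1(\bar r_1)\cup\dots\cup g_{h_1}(\bar r_{h_1})\cup R_1\cup\dots\cup R_{h_2}$ ($f_i,g_j\not\equiv\cup$, $L_i,R_j$ variables): (Normalization) introduce new variables $N^L_i$ for $f_i(\bar l_i)$ and $N^R_j$ for $g_j(\bar r_j)$; (Elementary $ACI1$ solution) compute the most general $ACI1$-unifier of the variable-only equation $N^L_1\cup\dots\cup N^L_{k_1}\cup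 L_1\cup\dots\cup L_{k_2}=N^R_1\cup\dots\cup N^R_{h_1}\cup R_1\cup\dots\cup R_{h_2}$, in which each variable $V$ is bound to a union of fresh variables $A_{\cdot,\cdot}$; let $\mathcal E^{ACI}_1$ be the bindings of the $L_i,R_j$ and $\mathcal E^{ACI}_2$ the bindings of the $N^L_i,N^R_j$ with these variables replaced by $f_i(\bar l_i)$, $g_j(\bar r_j)$; (Term propagation, non-deterministic) in a fixed order, for each $A$ occurring in a right-hand side of $\mathcal E^{ACI}_2$, with $f(\bar s)$ the left-hand side of the first equation containing it, set $\lambda(A)=\emptyset$ or $\lambda(A)=f(\bar s)$ and apply immediately; accept only if every equation becomes $f(\bar s)=f_1(\bar s_1)\cup\dots\cup f_h(\bar s_h)$ with $h\ge 1$ and all $f_i\equiv f$ (after removing $\emptyset$ and repetitions); let $\mathcal E_2$ consist of $\bar s=\bar s_1,\dots,\bar s=\bar s_h$ for each such equation, and $\mathcal E_1=\mathcal E^{ACI}_1\lambda$; (Variables removal) from $\mathcal E_1$ take the substitutions $\rho_X$ binding each $L_i,R_j$; with $X\Rightarrow Y$ iff $Y\in\mathrm{vars}(X\rho_X)$, fail if $X\Rightarrow^+X$ for some such $X$, else let $\rho$ be the composition of the $\rho_X$. Return $\langle\mathcal E_1,\mathcal E_2\rho,\rho\rangle$.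
   Formalization: Procedure corrected: cases (6),(7) exclude ∪, and case (8) takes all equations of non-variable terms with a union on some side; ∅ members are dropped in reorderings; aci_step returns E_1 with ρ applied to its right-hand sides. Otherwise X∪Y=a fails and E_s need not be in solved form. *)

(* Defs.v *)
From HB Require Import structures.
From mathcomp Require Import all_boot.
From Stdlib Require Import Relation_Operators.

Set Implicit Arguments.
Unset Strict Implicit.
Unset Printing Implicit Defensive.

(* [fsym] lists the free function symbols only; the constant for the empty set
   and the binary union are constructors of [term]. *)
Record signature := Signature { fsym :> eqType; arity : fsym -> nat }.

Inductive term (S : signature) : Type :=
| Var of nat
| Empty
| Union of term S & term S
| App (f : S) of {ffun 'I_(arity f) -> term S}.

Arguments Var {S} _.
Arguments Empty {S}.
Arguments Union {S} _ _.
Arguments App {S} f _.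

Section TermEq.
Variable S : signature.

Lemma term_ffun_ind (P : term S -> Prop) :
    (forall x, P (Var x)) -> P Empty ->
    (forall s t, P s -> P t -> P (Union s t)) ->
    (forall f (ts : {ffun 'I_(arity f) -> term S}),
        (forall i, P (ts i)) -> P (App f ts)) ->
  forall t, P t.
Proof.
move=> PV PE PU PA; fix IH 1; case=> [x||s t|f ts].
- exact: PV.
- exact: PE.
- exact: PU.
- by apply: PA => i; apply: IH.
Qed.

Fixpoint term_eqb (t u : term S) {struct t} : bool :=
  match t, u with
  | Var x, Var y => x == y
  | Empty, Empty => true
  | Union a b, Union c d => term_eqb a c && term_eqb b d
  | App f s, App g r =>
      match f =P g with
      | ReflectT e =>
          [forall i, term_eqb (s i) (r (cast_ord (congr1 (@arity S) e) i))]
      | ReflectF _ => false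
      end
  | _, _ => false
  end.

Lemma term_eqP : Equality.axiom term_eqb.
Proof.
move=> t u; apply: (iffP idP) => [|<-{u}].
  elim/term_ffun_ind: t u => [x||a b IHa IHb|f s IHs] [y||c d|g r] //=.
  - by move/eqP->.
  - by case/andP=> /IHa-> /IHb->.
  - case: eqP => // e; case: g / e r => r /forallP eq_sr.
    congr App; apply/ffunP=> i; rewrite (IHs _ _ (eq_sr i)).
    by congr (r _); apply: val_inj.
elim/term_ffun_ind: t => [x||a b IHa IHb|f s IHs] //=; first by rewrite IHa.
case: eqP => // e; apply/forallP=> i.
by rewrite (_ : cast_ord _ i = i) ?IHs //; apply: val_inj.
Qed.

HB.instance Definition _ := hasDecEq.Build (term S) term_eqP.

End TermEq.

Definition system (S : signature) := seq (term S * term S).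
Definition subst (S : signature) := nat -> term S.

Section Basics.
Variable S : signature.
Implicit Types (s t u : term S) (sigma theta : subst S) (E : system S).

Definition args t : seq (term S) :=
  if t is App f ts then [seq ts i | i <- enum 'I_(arity f)] else [::].

Definition head_sym t : option S := if t is App f _ then Some f else None.

Definition is_var t := if t is Var _ then true else false.
Definition is_union t := if t is Union _ _ then true else false.
Definition is_app t := if t is App _ _ then true else false.
Definition var_of t : option nat := if t is Var x then Some x else None.

Fixpoint vars t : seq nat :=
  match t with
  | Var x => [:: x]
  | Empty => [::]
  | Union s u => vars s ++ vars u
  | App f ts => flatten [seq vars (ts i) | i <- enum 'I_(arity f)]
  end.

Definition vars_sys E : seq nat := flatten [seq vars e.1 ++ vars e.2 | e <- E].

Fixpoint tsubst sigma t : term S :=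
  match t with
  | Var x => sigma x
  | Empty => Empty
  | Union s u => Union (tsubst sigma s) (tsubst sigma u)
  | App f ts => App f [ffun i => tsubst sigma (ts i)]
  end.

Definition subst_sys sigma E : system S :=
  [seq (tsubst sigma e.1, tsubst sigma e.2) | e <- E].

Definition subst1 (x : nat) t : subst S := fun y => if y == x then t else Var y.

(* Diagrammatic order: [sigma] is applied first. *)
Definition scomp sigma theta : subst S := fun x => tsubst theta (sigma x).

Inductive aci1 : term S -> term S -> Prop :=
| aci1_assoc x y z :
    aci1 (Union (Union (Var x) (Var y)) (Var z))
         (Union (Var x) (Union (Var y) (Var z)))
| aci1_comm x y : aci1 (Union (Var x) (Var y)) (Union (Var y) (Var x))
| aci1_idem x : aci1 (Union (Var x) (Var x)) (Var x)
| aci1_unit x : aci1 (Union (Var x) Empty) (Var x)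
| aci1_subst sigma s t :
    aci1 s t -> aci1 (tsubst sigma s) (tsubst sigma t)
| aci1_refl t : aci1 t t
| aci1_sym s t : aci1 s t -> aci1 t s
| aci1_trans s t u : aci1 s t -> aci1 t u -> aci1 s u
| aci1_union s s' t t' :
    aci1 s s' -> aci1 t t' -> aci1 (Union s t) (Union s' t')
| aci1_app (f : S) (ts us : {ffun 'I_(arity f) -> term S}) :
    (forall i, aci1 (ts i) (us i)) -> aci1 (App f ts) (App f us).

Definition unifier sigma E : Prop :=
  forall e, e \in E -> aci1 (tsubst sigma e.1) (tsubst sigma e.2).

Definition more_general (W : seq nat) theta sigma : Prop :=
  exists lambda : subst S,
    forall x, x \in W -> aci1 (sigma x) (tsubst lambda (theta x)).

Definition mgu theta E : Prop :=
  unifier theta E /\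
  forall sigma, unifier sigma E -> more_general (vars_sys E) theta sigma.

Definition solved_form E : Prop :=
  exists bs : seq (nat * term S),
    [/\ E = [seq (Var b.1, b.2) | b <- bs],
        uniq (unzip1 bs) &
        forall x b, x \in unzip1 bs -> b \in bs -> x \notin vars b.2].

Fixpoint subst_of E : subst S :=
  if E is e :: E' then
    fun y => if e.1 == Var y then e.2 else subst_of E' y
  else Var.

(* The union of no terms is [Empty]; no trailing [Empty] otherwise. *)
Fixpoint bigU (ts : seq (term S)) : term S :=
  match ts with
  | [::] => Empty
  | [:: t] => t
  | t :: ts' => Union t (bigU ts')
  end.

(* The reordering f1(..) U ... U fn(..) U V1 U ... U Vm of a term: its
   members, with occurrences of [Empty] dropped by the unit law. *)
Fixpoint members t : seq (term S) :=
  match t with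
  | Empty => [::]
  | Union s u => members s ++ members u
  | _ => [:: t]
  end.

Definition app_members t : seq (term S) := [seq u <- members t | is_app u].
Definition var_members t : seq nat := pmap var_of (members t).

End Basics.

Section AciStep.
Variable S : signature.
Implicit Types (l r : term S) (lam : subst S) (bind : nat -> seq nat).

Definition vunion (xs : seq nat) : term S := bigU [seq Var x | x <- xs].

(* Normalization and elementary solution: [NL], [NR] name the non-variable
   members of [l] and [r], and [bind x] lists the fresh variables whose union
   is the value at [x] of a most general unifier of the variable-only
   equation. *)
Record elementary_solution (used : seq nat) l r (NL NR : seq nat) bind : Prop :=
  ElementarySolution {
    es_sizeL : size NL = size (app_members l);
    es_sizeR : size NR = size (app_members r);
    es_uniq : uniq (NL ++ NR);
    es_new : forall x, x \in NL ++ NR -> x \notin used;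
    es_fresh : forall x a,
      x \in (NL ++ var_members l) ++ (NR ++ var_members r) -> a \in bind x ->
      a \notin used ++ NL ++ NR;
    es_mgu : mgu (fun x => vunion (bind x))
                 [:: (vunion (NL ++ var_members l),
                      vunion (NR ++ var_members r))]
  }.

Definition step_vars l r : seq nat := undup (var_members l ++ var_members r).

(* The bindings of the names, with each name replaced by the term it stands
   for and each right-hand side given as a list of variables. *)
Definition named_bindings l r (NL NR : seq nat) bind :
    seq (term S * seq nat) :=
  zip (app_members l ++ app_members r) [seq bind x | x <- NL ++ NR].

Definition propagation (E2 : seq (term S * seq nat)) lam : Prop :=
  forall a,
    match [seq p <- E2 | a \in p.2] with
    | [::] => lam a = Var a
    | p :: _ => lam a = Empty \/ lam a = p.1
    end.

Definition propagated lam (p : term S * seq nat) : seq (term S) :=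
  undup [seq u <- [seq lam a | a <- p.2] | u != Empty].

Definition accepted (E2 : seq (term S * seq nat)) lam : bool :=
  all (fun p => (0 < size (propagated lam p)) &&
                all (fun u => head_sym u == head_sym p.1) (propagated lam p)) E2.

Definition argument_system (E2 : seq (term S * seq nat)) lam : system S :=
  flatten [seq flatten [seq zip (args p.1) (args u) | u <- propagated lam p]
          | p <- E2].

Definition rhs bind lam (x : nat) : term S := tsubst lam (vunion (bind x)).

Definition depends l r bind lam (x y : nat) : bool :=
  (x \in step_vars l r) && (y \in vars (rhs bind lam x)).

Definition cyclic l r bind lam : Prop :=
  exists2 x, x \in step_vars l r &
             clos_trans nat (fun x y => depends l r bind lam x y) x x.

(* The substitutions binding single variables are composed in an order in
   which x precedes y whenever the value of x mentions y. *)
Definition removal_order l r bind lam (xs : seq nat) : Prop :=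
  perm_eq xs (step_vars l r) /\
  pairwise (fun x y => ~~ depends l r bind lam y x) xs.

Definition composition bind lam (xs : seq nat) : subst S :=
  foldl (fun rho x => scomp rho (subst1 x (rhs bind lam x))) Var xs.

(* A result consists of the variables introduced, the solved equations, the
   equations still to be solved and a substitution; [None] is failure. The
   composed substitution is applied to the right-hand sides of the solved
   equations: those may mention other variables of the step inside propagated
   terms, and would otherwise not be in solved form. *)
Variant aci_step (used : seq nat) l r :
    option (seq nat * system S * system S * subst S) -> Prop :=
| aci_reject NL NR bind lam :
    elementary_solution used l r NL NR bind ->
    propagation (named_bindings l r NL NR bind) lam ->
    ~~ accepted (named_bindings l r NL NR bind) lam ->
    aci_step used l r None
| aci_cyclic NL NR bind lam :
    elementary_solution used l r NL NR bind ->
    propagation (named_bindings l r NL NR bind) lam ->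
    accepted (named_bindings l r NL NR bind) lam ->
    cyclic l r bind lam ->
    aci_step used l r None
| aci_done NL NR bind lam xs :
    elementary_solution used l r NL NR bind ->
    propagation (named_bindings l r NL NR bind) lam ->
    accepted (named_bindings l r NL NR bind) lam ->
    ~ cyclic l r bind lam ->
    removal_order l r bind lam xs ->
    let rho := composition bind lam xs in
    aci_step used l r
      (Some ((NL ++ NR) ++
               flatten [seq bind x | x <- (NL ++ NR) ++ step_vars l r],
             [seq (Var x, tsubst rho (rhs bind lam x)) | x <- step_vars l r],
             subst_sys rho
               (argument_system (named_bindings l r NL NR bind) lam),
             rho)).

End AciStep.

(* [used] collects every variable that has ever occurred, so that new
   variables also avoid those no longer present in either system. *)
Record state (S : signature) := State {
  used : seq nat;
  solved : system S;
  todo : system S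
}.

Section GeneralAci.
Variable S : signature.
Implicit Types (s t l r : term S) (E Es : system S) (U : seq nat).

(* [act U Es E e o]: [E] is what is left of the unsolved equations once [e] has
   been removed, and [o] is the next state, [None] being failure. The clash and
   decomposition cases concern the free symbols and [Empty]; every equation
   between non-variable terms with a union on at least one side goes to
   [aci_step], a term that is not a union counting as a one-member union (or,
   for [Empty], as a union without members). *)
Variant act U Es E : term S * term S -> option (state S) -> Prop :=
| act_trivial x :
    act U Es E (Var x, Var x) (Some (State U Es E))
| act_orient t x :
    ~~ is_var t ->
    act U Es E (t, Var x) (Some (State U Es ((Var x, t) :: E)))
| act_occurs x t :
    x \in flatten [seq vars u | u <- app_members t] ->
    act U Es E (Var x, t) None
| act_eliminate x t :
    x \notin vars t ->
    act U Es E (Var x, t)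
      (Some (State U ((Var x, t) :: subst_sys (subst1 x t) Es)
                     (subst_sys (subst1 x t) E)))
| act_top_occurs x t n :
    ~~ is_var t ->
    x \in var_members t ->
    x \notin flatten [seq vars u | u <- app_members t] ->
    n \notin U ->
    act U Es E (Var x, t)
      (Some (State (n :: U) Es
         ((Var x, Union (bigU [seq u <- members t | u != Var x]) (Var n))
            :: E)))
| act_clash s t :
    ~~ is_var s -> ~~ is_var t -> ~~ is_union s -> ~~ is_union t ->
    head_sym s != head_sym t ->
    act U Es E (s, t) None
| act_decompose s t :
    ~~ is_var s -> ~~ is_var t -> ~~ is_union s -> ~~ is_union t ->
    head_sym s = head_sym t ->
    act U Es E (s, t) (Some (State U Es (zip (args s) (args t) ++ E)))
| act_union_fail l r :
    ~~ is_var l -> ~~ is_var r -> is_union l || is_union r ->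
    aci_step U l r None ->
    act U Es E (l, r) None
| act_union l r V E1 E2 theta :
    ~~ is_var l -> ~~ is_var r -> is_union l || is_union r ->
    aci_step U l r (Some (V, E1, E2, theta)) ->
    act U Es E (l, r)
      (Some (State (V ++ U) (subst_sys theta Es ++ E1)
                            (subst_sys theta E ++ E2))).

Variant step : state S -> option (state S) -> Prop :=
| step_select U Es E E' e o :
    act U Es (E ++ E') e o -> step (State U Es (E ++ e :: E')) o.

Inductive branch : state S -> system S -> Prop :=
| branch_done U Es : branch (State U Es [::]) Es
| branch_step st st' Es :
    step st (Some st') -> branch st' Es -> branch st Es.

Definition general_aci E Es : Prop := branch (State (vars_sys E) [::] E) Es.

End GeneralAci.

(* Main.v *)
From Stdlib Require Import Relation_Operators Morphisms ClassicalEpsilon.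
From Stdlib Require Import Wf_nat Inclusion Lexicographic_Product.
From Stdlib Require Import List_Extension.
From mathcomp Require Import all_boot.
Require Import Defs.

Set Implicit Arguments.
Unset Strict Implicit.
Unset Printing Implicit Defensive.

(** Correctness: no step adds a unifier. Along a branch, the left-hand sides of
the solved equations are distinct variables that occur nowhere else, so the
final system is solved and its substitution unifies it, hence unifies all
the previous systems.

Completeness: a unifier [sigma] of the current state, extended to the new
variables, selects a branch. In an ACI1 step, the mgu of the variable-only
equation factors [sigma] through some [lambda]; since the value of a name is a
single non-variable member, [lambda] sends each new variable bound to a name
either to the empty set or to that member, which dictates the propagation.
The depth of the value under [sigma] is invariant modulo ACI1 and decreases
strictly along the dependencies of the step, so there is no cycle and sorting
by depth gives a removal order. Arguments are less deep than the terms they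
come from, so each step decreases the multiset of the depths of the
[sigma]-instances of the unsolved left-hand sides, except the steps preparing
an equation for its elimination, of which at most two occur in a row. Hence the
selected branch is finite. *)

(** * Sequences and multisets *)

Lemma mem_zip (T1 T2 : eqType) (A : seq T1) (B : seq T2) p :
  p \in zip A B -> p.1 \in A /\ p.2 \in B.
Proof.
elim: A B => [|a A IH] [|b B] //=; rewrite !inE => /predU1P[->|/IH[-> ->]].
  by rewrite !eqxx.
by rewrite !orbT.
Qed.

Lemma nth_index_zip (T1 T2 : eqType) (x0 : T1) (A : seq T1) (B : seq T2) a b :
  uniq B -> (a, b) \in zip A B -> nth x0 A (index b B) = a.
Proof.
elim: A B => [|a' A IH] [|b' B] //= /andP[b'B uB]; rewrite inE.
case/predU1P=> [[-> ->]|ab]; first by rewrite eqxx.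
rewrite ifN; first exact: IH.
by apply: contraNneq b'B => ->; case: (mem_zip ab).
Qed.

Section MultisetExtension.
Variables (T : eqType) (R : T -> T -> Prop).

Definition multiset_ext (m' m : seq T) : Prop :=
  exists a bs k,
    [/\ perm_eq m (a :: k), perm_eq m' (bs ++ k) & {in bs, forall b, R b a}].

Lemma Acc_multiset_ext m m' :
  Acc (list_ext T R) m -> perm_eq m m' -> Acc multiset_ext m'.
Proof.
move=> acc_m; elim: acc_m m' => {}m _ IH m' pm.
constructor=> n [a [bs [k [pm' pn lt_bs]]]].
have pmk := perm_trans pm pm'.
have a_m : a \in m by rewrite (perm_mem pmk) mem_head.
case/splitPr: a_m pmk IH {pm} => m1 m2; rewrite perm_catC /= perm_cons => pk IH.
apply: (IH (m1 ++ bs ++ m2)); last first.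
  by rewrite perm_catCA (permPr pn) perm_cat2l perm_catC.
constructor; elim: bs lt_bs {pn} => // b bs IHbs lt_bs; constructor.
  by apply: lt_bs; apply: mem_head.
by apply: IHbs => c c_in; apply: lt_bs; rewrite inE c_in orbT.
Qed.

Lemma multiset_ext_wf : well_founded R -> well_founded multiset_ext.
Proof.
move=> wfR m; exact: Acc_multiset_ext (wf_list_ext T R wfR m) (perm_refl m).
Qed.

End MultisetExtension.

Lemma ltn_wf : well_founded (fun m n : nat => m < n).
Proof. by apply: (wf_incl _ _ lt) lt_wf => m n /ltP. Qed.

(** * Members and variables of terms *)

Section Terms.
Variable S : signature.
Implicit Types (s t u : term S) (sigma tau : subst S) (ts : seq (term S)).

Definition is_atom t : bool := is_var t || is_app t.

Lemma all_atom_members s : all (@is_atom) (members s).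
Proof.
by elim/term_ffun_ind: s => [x||s t IHs IHt|f ts _] //=; rewrite all_cat IHs.
Qed.

Lemma mem_members_atom s u : u \in members s -> is_atom u.
Proof. by move/(allP (all_atom_members s)). Qed.

Lemma members_atom u : is_atom u -> members u = [:: u].
Proof. by case: u. Qed.

Lemma mem_var_members s x : (x \in var_members s) = (Var x \in members s).
Proof.
rewrite /var_members; elim: (members s) => //= -[y||? ?|f ts] l IHl /=;
  by rewrite ?inE IHl //=; congr (_ || _).
Qed.

Lemma members_bigU_atoms ts : all is_atom ts -> members (bigU ts) = ts.
Proof.
elim: ts => [|s [|s' ts] IH] //=; first by rewrite andbT; apply: members_atom.
by case/andP=> /members_atom-> /IH /= ->.
Qed.

Lemma members_bigU_filter (P : pred (term S)) t :
  members (bigU (filter P (members t))) = filter P (members t).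
Proof.
apply: members_bigU_atoms; rewrite all_filter; apply/allP => u ut.
by rewrite /= (mem_members_atom ut) implybT.
Qed.

Lemma members_vunion xs : members (vunion S xs) = [seq Var x | x <- xs].
Proof. by rewrite members_bigU_atoms // all_map; apply/allP. Qed.

Lemma vars_members s : vars s = flatten [seq vars u | u <- members s].
Proof.
elim/term_ffun_ind: s => [x||s t IHs IHt|f ts _] //=; last by rewrite cats0.
by rewrite map_cat flatten_cat -IHs -IHt.
Qed.

Lemma vars_vunion xs : vars (vunion S xs) = xs.
Proof. by rewrite vars_members members_vunion -map_comp flatten_seq1. Qed.

Lemma vars_member s u : u \in members s -> {subset vars u <= vars s}.
Proof.
by move=> us x xu; rewrite vars_members; apply/flatten_mapP; exists u.
Qed.

Lemma vars_var_members s : {subset var_members s <= vars s}.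
Proof.
by move=> x; rewrite mem_var_members => /vars_member; apply; apply: mem_head.
Qed.

Lemma app_memberP s u :
  u \in app_members s -> is_app u /\ {subset vars u <= vars s}.
Proof. by rewrite mem_filter => /andP[u_app /vars_member]. Qed.

Lemma vars_split s x : x \in vars s ->
  x \in flatten [seq vars u | u <- app_members s] \/ x \in var_members s.
Proof.
rewrite vars_members => /flatten_mapP[u us xu].
have /orP[] := mem_members_atom us; last first.
  move=> u_app; left; apply/flatten_mapP; exists u => //.
  by rewrite mem_filter u_app.
case: u us xu => // y ys; rewrite inE => /eqP-> _.
by right; rewrite mem_var_members.
Qed.

Definition other_members m t : seq (term S) := [seq u <- members t | u != m].

Lemma vars_bigU_other m t : {subset vars (bigU (other_members m t)) <= vars t}.
Proof.
move=> y; rewrite vars_members members_bigU_filter => /flatten_mapP[u].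
by rewrite mem_filter => /andP[_ ut]; apply: vars_member.
Qed.

Lemma notin_vars_bigU_other x t :
  x \notin flatten [seq vars u | u <- app_members t] ->
  x \notin vars (bigU (other_members (Var x) t)).
Proof.
move=> x_app; apply/negP => /vars_split[|]; last first.
  by rewrite mem_var_members members_bigU_filter mem_filter eqxx.
apply/negP; apply: contra x_app => /flatten_mapP[u].
rewrite mem_filter members_bigU_filter mem_filter => /and3P[u_app _ ut] xu.
by apply/flatten_mapP; exists u; rewrite // mem_filter u_app.
Qed.

Lemma tsubst_ext sigma tau t :
  {in vars t, sigma =1 tau} -> tsubst sigma t = tsubst tau t.
Proof.
elim/term_ffun_ind: t => [x||s t IHs IHt|f ts IHts] //= st.
- by apply: st; rewrite inE.
- by rewrite IHs ?IHt // => x xs; apply: st; rewrite mem_cat xs ?orbT.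
- congr App; apply/ffunP=> i; rewrite !ffunE; apply: IHts => x xi.
  by apply: st; apply/flatten_mapP; exists i; rewrite ?mem_enum.
Qed.

Lemma tsubst_Var t : tsubst Var t = t.
Proof.
elim/term_ffun_ind: t => [x||s t /= -> ->|f ts IHts] //=.
by congr App; apply/ffunP=> i; rewrite ffunE.
Qed.

Lemma tsubst_scomp sigma tau t :
  tsubst tau (tsubst sigma t) = tsubst (scomp sigma tau) t.
Proof.
elim/term_ffun_ind: t => [x||s t /= -> ->|f ts IHts] //=.
by congr App; apply/ffunP=> i; rewrite !ffunE.
Qed.

Lemma vars_tsubst sigma t :
  vars (tsubst sigma t) = flatten [seq vars (sigma x) | x <- vars t].
Proof.
elim/term_ffun_ind: t => [x||s t IHs IHt|f ts IHts] //=; first by rewrite cats0.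
  by rewrite map_cat flatten_cat IHs IHt.
elim: (enum _) => //= i js IH.
by rewrite map_cat flatten_cat -IH ffunE IHts.
Qed.

Lemma members_tsubst sigma s :
  members (tsubst sigma s) =
  flatten [seq members (tsubst sigma u) | u <- members s].
Proof.
elim/term_ffun_ind: s => [x||s t IHs IHt|f ts _] //=; first by rewrite cats0.
by rewrite map_cat flatten_cat IHs IHt.
Qed.

Lemma is_app_tsubst sigma t : is_app t -> is_app (tsubst sigma t).
Proof. by case: t. Qed.

Lemma head_sym_tsubst sigma t :
  is_app t -> head_sym (tsubst sigma t) = head_sym t.
Proof. by case: t. Qed.

Lemma nth_args (f : S) (ts : {ffun 'I_(arity f) -> term S}) (i : 'I_(arity f)) :
  nth Empty (args (App f ts)) i = ts i.
Proof. by rewrite (nth_map i) ?size_enum_ord // nth_ord_enum. Qed.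

Lemma nth_args_default (f : S) (ts : {ffun 'I_(arity f) -> term S}) i :
  arity f <= i -> nth Empty (args (App f ts)) i = Empty.
Proof. by move=> le_i; rewrite nth_default // size_map size_enum_ord. Qed.

Lemma vars_args t u : u \in args t -> {subset vars u <= vars t}.
Proof.
case: t => // f ts /mapP[i _ ->] x xi.
by apply/flatten_mapP; exists i; rewrite ?mem_enum.
Qed.

Lemma zip_args (f : S) (ts us : {ffun 'I_(arity f) -> term S}) :
  zip (args (App f ts)) (args (App f us)) =
  [seq (ts i, us i) | i <- enum 'I_(arity f)].
Proof. exact: zip_map. Qed.

End Terms.

(** * Terms modulo ACI1 as a semilattice *)

#[local] Instance aci1_Equivalence (S : signature) : Equivalence (@aci1 S).
Proof.
split=> [t|s t|s t u]; [exact: aci1_refl | exact: aci1_sym | exact: aci1_trans].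
Qed.

#[local] Hint Resolve aci1_refl : core.

#[local] Instance Union_aci1_Proper (S : signature) :
  Proper (@aci1 S ==> @aci1 S ==> @aci1 S) (@Union S).
Proof. by move=> s s' ss t t' tt; apply: aci1_union. Qed.

Definition aci_le (S : signature) (s t : term S) : Prop := aci1 (Union s t) t.

#[local] Instance aci_le_Proper (S : signature) :
  Proper (@aci1 S ==> @aci1 S ==> iff) (@aci_le S).
Proof. by move=> s s' ss t t' tt; rewrite /aci_le ss tt. Qed.

Section Semilattice.
Variable S : signature.
Implicit Types (s t u : term S) (sigma tau : subst S).

Lemma aci1_unionA s t u :
  aci1 (Union (Union s t) u) (Union s (Union t u)).
Proof. exact: (aci1_subst (nth Empty [:: s; t; u]) (aci1_assoc S 0 1 2)). Qed.

Lemma aci1_unionC s t : aci1 (Union s t) (Union t s).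
Proof. exact: (aci1_subst (nth Empty [:: s; t]) (aci1_comm S 0 1)). Qed.

Lemma aci1_unionss s : aci1 (Union s s) s.
Proof. exact: (aci1_subst (nth Empty [:: s]) (aci1_idem S 0)). Qed.

Lemma aci1_unions0 s : aci1 (Union s Empty) s.
Proof. exact: (aci1_subst (nth Empty [:: s]) (aci1_unit S 0)). Qed.

Lemma aci_le_refl s : aci_le s s.
Proof. exact: aci1_unionss. Qed.

Lemma aci_le_trans t s u : aci_le s t -> aci_le t u -> aci_le s u.
Proof. by rewrite /aci_le => st tu; rewrite -tu -aci1_unionA st. Qed.

Lemma aci_le_anti s t : aci_le s t -> aci_le t s -> aci1 s t.
Proof. by rewrite /aci_le => st ts; rewrite -st aci1_unionC ts. Qed.

Lemma aci_leUl s t : aci_le s (Union s t).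
Proof. by rewrite /aci_le -aci1_unionA aci1_unionss. Qed.

Lemma aci_leUr s t : aci_le t (Union s t).
Proof. by rewrite aci1_unionC; apply: aci_leUl. Qed.

Lemma aci_le0 t : aci_le Empty t.
Proof. by rewrite /aci_le aci1_unionC aci1_unions0. Qed.

Lemma aci_leU s t u : aci_le (Union s t) u <-> aci_le s u /\ aci_le t u.
Proof.
split=> [stu|[su tu]]; last by rewrite /aci_le aci1_unionA tu.
by split; apply: aci_le_trans stu; [apply: aci_leUl | apply: aci_leUr].
Qed.

Lemma aci1_le_ext s t : (forall u, aci_le s u <-> aci_le t u) -> aci1 s t.
Proof.
move=> st; apply: aci_le_anti; first exact/st/aci_le_refl.
exact/(st s)/aci_le_refl.
Qed.

Lemma tsubst_aci1 sigma tau t :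
  (forall x, x \in vars t -> aci1 (sigma x) (tau x)) ->
  aci1 (tsubst sigma t) (tsubst tau t).
Proof.
elim/term_ffun_ind: t => [x||s t IHs IHt|f ts IHts] //= st.
- by apply: st; rewrite inE.
- by apply: aci1_union; [apply: IHs | apply: IHt] => x xs; apply: st;
    rewrite mem_cat xs ?orbT.
- apply: aci1_app => i; rewrite !ffunE; apply: IHts => x xi.
  by apply: st; apply/flatten_mapP; exists i; rewrite ?mem_enum.
Qed.

Lemma le_tsubst_members sigma s t :
  aci_le (tsubst sigma s) t <->
  (forall u, u \in members s -> aci_le (tsubst sigma u) t).
Proof.
have le_single u : (forall v, v \in [:: u] -> aci_le (tsubst sigma v) t) <->
    aci_le (tsubst sigma u) t.
  by split=> [|le v]; [apply; apply: mem_head | rewrite inE => /eqP->].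
elim/term_ffun_ind: s => [x||s1 s2 IH1 IH2|f ts _]; rewrite ?le_single //.
  by split=> // _; apply: aci_le0.
rewrite /= aci_leU IH1 IH2; split=> [[le_s1 le_s2] u|le].
  by rewrite mem_cat => /orP[/le_s1|/le_s2].
by split=> u us; apply: le; rewrite mem_cat us ?orbT.
Qed.

Lemma le_members s t :
  aci_le s t <-> (forall u, u \in members s -> aci_le u t).
Proof.
have:= le_tsubst_members Var s t; rewrite tsubst_Var => ->.
by split=> le u /le; rewrite tsubst_Var.
Qed.

Lemma member_tsubst_le sigma s u :
  u \in members s -> aci_le (tsubst sigma u) (tsubst sigma s).
Proof. by move: u; apply/le_tsubst_members/aci_le_refl. Qed.

Lemma member_le s u : u \in members s -> aci_le u s.
Proof. by move: u; apply/le_members/aci_le_refl. Qed.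

Lemma le_vunion sigma xs t :
  aci_le (tsubst sigma (vunion S xs)) t <->
  (forall x, x \in xs -> aci_le (sigma x) t).
Proof.
rewrite le_tsubst_members members_vunion.
split=> [le x x_in|le _ /mapP[x x_in ->]]; last exact: le.
exact: le (map_f _ x_in).
Qed.

Lemma mem_vunion_le sigma xs x :
  x \in xs -> aci_le (sigma x) (tsubst sigma (vunion S xs)).
Proof. by move: x; apply/le_vunion/aci_le_refl. Qed.

Lemma member_aci1 m t : m \in members t ->
  aci1 t (Union m (bigU (other_members m t))).
Proof.
move=> mt; apply: aci1_le_ext => w.
rewrite aci_leU (le_members t) (le_members (bigU _)) members_bigU_filter.
split=> [le|[le_m le] u ut].
  by split=> [|u]; [apply: le | rewrite mem_filter => /andP[_]; apply: le].
by have [->//|um] := eqVneq u m; apply: le; rewrite mem_filter um.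
Qed.

Lemma members0_aci1 s : members s = [::] -> aci1 s Empty.
Proof.
move=> s0; apply: aci_le_anti; last exact: aci_le0.
by apply/le_members; rewrite s0.
Qed.

End Semilattice.

#[local] Hint Resolve aci_le_refl : core.

(** * Freeness: equal terms have equal members *)

Section Freeness.
Variable S : signature.
Implicit Types (s t u m : term S) (sigma : subst S).

(* Arguments are compared by position, with default [Empty], to avoid a
   transport along the equality of the head symbols. *)
Definition member_eq m m' : Prop :=
  [/\ var_of m = var_of m', head_sym m = head_sym m' &
      forall i, aci1 (nth Empty (args m) i) (nth Empty (args m') i)].

Definition sub_members s t : Prop :=
  forall m, m \in members s -> exists2 m', m' \in members t & member_eq m m'.

Lemma member_eq_refl m : member_eq m m.
Proof. by split. Qed.

Lemma member_eq_trans m2 m1 m3 :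
  member_eq m1 m2 -> member_eq m2 m3 -> member_eq m1 m3.
Proof.
case=> v12 h12 a12 [v23 h23 a23]; split=> [||i]; rewrite ?v12 ?h12 //.
by rewrite a12.
Qed.

Lemma member_eq_app (f : S) (ts us : {ffun 'I_(arity f) -> term S}) :
  (forall i, aci1 (ts i) (us i)) -> member_eq (App f ts) (App f us).
Proof.
move=> tu; split=> // i; have [lt_i|ge_i] := ltnP i (arity f); last first.
  by rewrite !nth_args_default.
by rewrite !(nth_args _ (Ordinal lt_i)).
Qed.

Lemma member_eq_aci1 m m' :
  is_atom m -> is_atom m' -> member_eq m m' -> aci1 m m'.
Proof.
case: m => [x||? ?|f ts]; case: m' => [y||? ?|g us] // _ _ [] //.
  by case=> ->.
move=> _ [efg]; subst g => eqa; apply: aci1_app => i.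
by have:= eqa i; rewrite !nth_args.
Qed.

Lemma sub_members_refl s t : members s =i members t -> sub_members s t.
Proof. by move=> st m ms; exists m; rewrite -?st //; apply: member_eq_refl. Qed.

Lemma sub_members_trans t s u :
  sub_members s t -> sub_members t u -> sub_members s u.
Proof.
move=> st tu m /st[m' /tu[m'' m''u e'] e]; exists m'' => //.
exact: member_eq_trans e e'.
Qed.

Lemma sub_members_union s s' t t' : sub_members s s' -> sub_members t t' ->
  sub_members (Union s t) (Union s' t').
Proof.
move=> ss tt m; rewrite mem_cat => /orP[/ss|/tt] [m' m'in e];
  by exists m'; rewrite // mem_cat m'in ?orbT.
Qed.

Lemma sub_members_app (f : S) (ts us : {ffun 'I_(arity f) -> term S}) :
  (forall i, aci1 (ts i) (us i)) -> sub_members (App f ts) (App f us).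
Proof.
move=> tu m; rewrite inE => /eqP->; exists (App f us); first exact: mem_head.
exact: member_eq_app.
Qed.

Lemma member_eq_tsubst sigma m m' : is_atom m -> is_atom m' ->
  member_eq m m' -> sub_members (tsubst sigma m) (tsubst sigma m').
Proof.
case: m => [x||? ?|f ts]; case: m' => [y||? ?|g us] // _ _ [] //.
  by case=> -> *; apply: sub_members_refl.
move=> _ [efg]; subst g => eqa; apply: sub_members_app => i; rewrite !ffunE.
by apply: aci1_subst; have:= eqa i; rewrite !nth_args.
Qed.

Lemma sub_members_tsubst sigma s t :
  sub_members s t -> sub_members (tsubst sigma s) (tsubst sigma t).
Proof.
move=> st m; rewrite !members_tsubst => /flatten_mapP[u us mu].
have [u' u't uu'] := st _ us.
have [|m' m'u' mm'] := member_eq_tsubst _ (mem_members_atom u't) uu' mu.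
  exact: mem_members_atom us.
by exists m' => //; apply/flatten_mapP; exists u'.
Qed.

Lemma aci1_sub_members s t : aci1 s t -> sub_members s t /\ sub_members t s.
Proof.
elim=> {s t}.
- by move=> x y z; split; apply: sub_members_refl => m; rewrite !inE.
- by move=> x y; split; apply: sub_members_refl => m; rewrite !inE orbC.
- by move=> x; split; apply: sub_members_refl => m; rewrite !inE orbb.
- by move=> x; split; apply: sub_members_refl.
- by move=> sigma s t _ [st ts]; split; apply: sub_members_tsubst.
- by move=> t; split; apply: sub_members_refl.
- by move=> s t _ [].
- move=> s t u _ [st ts] _ [tu ut].
  by split; [apply: sub_members_trans st tu | apply: sub_members_trans ut ts].
- by move=> s s' t t' _ [ss s's] _ [tt t't]; split; apply: sub_members_union.
- move=> f ts us tu _; split; apply: sub_members_app => // i.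
  by symmetry.
Qed.

Lemma aci1_head_sym s t : is_app s -> is_app t -> aci1 s t ->
  head_sym s = head_sym t.
Proof.
case: s => // f ts _; case: t => // g us _ /aci1_sub_members[st _].
by have [|m'] := st (App f ts); rewrite inE // => /eqP-> [].
Qed.

Lemma aci1_app_inj (f : S) (ts us : {ffun 'I_(arity f) -> term S}) i :
  aci1 (App f ts) (App f us) -> aci1 (ts i) (us i).
Proof.
case/aci1_sub_members=> st _; have [|m'] := st (App f ts); first by rewrite inE.
by rewrite inE => /eqP-> [_ _ /(_ i)]; rewrite !nth_args.
Qed.

Lemma atom_leP m t : is_atom m ->
  aci_le m t <-> exists2 u, u \in members t & aci1 m u.
Proof.
move=> m_atom; split=> [/aci1_sub_members[mt _]|[u ut ->]]; last first.
  exact: member_le.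
have [|u ut e] := mt m; first by rewrite /= members_atom ?mem_head.
by exists u => //; apply: member_eq_aci1 => //; apply: mem_members_atom ut.
Qed.

Lemma aci1_atom_ext s t :
  (forall m, is_atom m -> aci_le m s <-> aci_le m t) -> aci1 s t.
Proof.
move=> st; apply: aci_le_anti; apply/le_members => m m_in;
  by apply/(st m (mem_members_atom m_in))/member_le.
Qed.

Lemma atom_le0 m : is_atom m -> ~ aci_le m Empty.
Proof. by move/atom_leP=> -> []. Qed.

Lemma le_atom s u : is_atom u -> aci_le s u -> aci1 s Empty \/ aci1 s u.
Proof.
move=> u_atom le_su; case Es: (members s) => [|m ms].
  by left; apply: members0_aci1.
have m_s : m \in members s by rewrite Es mem_head.
have m_atom := mem_members_atom m_s.
have le_mu : aci_le m u := aci_le_trans (member_le m_s) le_su.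
have [u'] := (atom_leP u m_atom).1 le_mu.
rewrite members_atom // inE => /eqP-> mu.
by right; apply: aci_le_anti => //; rewrite -mu; apply: member_le.
Qed.

Lemma atom_le_vunion sigma xs m : is_atom m ->
  aci_le m (tsubst sigma (vunion S xs)) <->
  exists2 x, x \in xs & aci_le m (sigma x).
Proof.
move=> m_atom; split=> [|[x x_in mx]]; last first.
  exact: aci_le_trans mx (mem_vunion_le _ x_in).
case/(atom_leP _ m_atom)=> u; rewrite members_tsubst members_vunion -map_comp.
case/flatten_mapP=> x x_in ux mu; exists x => //.
by apply/atom_leP => //; exists u.
Qed.

End Freeness.

(** * Depth *)

Section Depth.
Variable S : signature.
Implicit Types (s t : term S) (sigma : subst S) (v : nat -> nat).

Fixpoint depth v t : nat :=
  match t with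
  | Var x => v x
  | Empty => 0
  | Union s u => maxn (depth v s) (depth v u)
  | App f ts => (\max_(i < arity f) depth v (ts i)).+1
  end.

Lemma depth_tsubst v sigma t :
  depth v (tsubst sigma t) = depth (fun x => depth v (sigma x)) t.
Proof.
elim/term_ffun_ind: t => [x||s t /= -> ->|f ts IHts] //=.
by congr _.+1; apply: eq_bigr => i _; rewrite ffunE.
Qed.

(* The valuation is universally quantified to get through [aci1_subst]. *)
Lemma depth_aci1 s t : aci1 s t -> forall v, depth v s = depth v t.
Proof.
elim=> {s t}.
- by move=> x y z v; rewrite /= maxnA.
- by move=> x y v; rewrite /= maxnC.
- by move=> x v; rewrite /= maxnn.
- by move=> x v; rewrite /= maxn0.
- by move=> sigma s t _ IH v; rewrite !depth_tsubst IH.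
- by [].
- by move=> s t _ IH v.
- by move=> s t u _ IH1 _ IH2 v; rewrite IH1.
- by move=> s s' t t' _ IH1 _ IH2 v; rewrite /= IH1 IH2.
- by move=> f ts us _ IH v /=; congr _.+1; apply: eq_bigr => i _.
Qed.

Lemma depth_le v s t : aci_le s t -> depth v s <= depth v t.
Proof. by move/depth_aci1/(_ v) <-; rewrite /= leq_maxl. Qed.

Lemma depth_arg v (f : S) (ts : {ffun 'I_(arity f) -> term S}) i :
  depth v (ts i) < depth v (App f ts).
Proof. by rewrite ltnS; apply: (leq_bigmax i). Qed.

Lemma depth_var v t x : x \in vars t -> v x <= depth v t.
Proof.
elim/term_ffun_ind: t => [y||s t IHs IHt|f ts IHts] //.
- by rewrite inE => /eqP->.
- by rewrite /= mem_cat leq_max => /orP[/IHs->|/IHt->]; rewrite ?orbT.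
- case/flatten_mapP=> i _ /IHts /leq_trans; apply.
  exact/ltnW/depth_arg.
Qed.

Lemma depth_app_var v t x : is_app t -> x \in vars t -> v x < depth v t.
Proof.
case: t => // f ts _ /flatten_mapP[i _ /(depth_var v)].
by move/leq_ltn_trans; apply; apply: depth_arg.
Qed.

Definition weight sigma t : nat := depth (fun=> 0) (tsubst sigma t).

Lemma weight_aci1 sigma s t :
  aci1 (tsubst sigma s) (tsubst sigma t) -> weight sigma s = weight sigma t.
Proof. by move/depth_aci1/(_ (fun=> 0)). Qed.

Lemma weight_le sigma s t :
  aci_le (tsubst sigma s) (tsubst sigma t) -> weight sigma s <= weight sigma t.
Proof. exact: depth_le. Qed.

Lemma weight_app_var sigma t x :
  is_app t -> x \in vars t -> weight sigma (Var x) < weight sigma t.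
Proof.
by move=> t_app xt; rewrite /weight !depth_tsubst; apply: depth_app_var.
Qed.

Lemma weight_args sigma s t :
  is_app s -> t \in args s -> weight sigma t < weight sigma s.
Proof.
case: s => // f ts _ /mapP[i _ ->]; rewrite /weight !depth_tsubst.
exact: depth_arg.
Qed.

End Depth.

(** * Systems of equations *)

Section Systems.
Variable S : signature.
Implicit Types (s t : term S) (sigma tau theta : subst S).
Implicit Types (E : system S) (e : term S * term S).

Lemma vars_sys_cat E E' : vars_sys (E ++ E') = vars_sys E ++ vars_sys E'.
Proof. by rewrite /vars_sys map_cat flatten_cat. Qed.

Lemma vars_sys_cons e E :
  vars_sys (e :: E) = (vars e.1 ++ vars e.2) ++ vars_sys E.
Proof. by []. Qed.

Lemma perm_vars_sys E E' : perm_eq E E' -> perm_eq (vars_sys E) (vars_sys E').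
Proof. by move=> pE; apply/perm_flatten/perm_map. Qed.

Lemma vars_subst_sys theta E :
  vars_sys (subst_sys theta E) = flatten [seq vars (theta x) | x <- vars_sys E].
Proof.
rewrite /vars_sys; elim: E => //= e E ->.
by rewrite !map_cat !flatten_cat !vars_tsubst.
Qed.

Lemma vars_zip_args s t :
  {subset vars_sys (zip (args s) (args t)) <= vars s ++ vars t}.
Proof.
move=> x /flatten_mapP[e /mem_zip[e1 e2]].
by rewrite !mem_cat => /orP[/(vars_args e1)->|/(vars_args e2)->]; rewrite ?orbT.
Qed.

Lemma unifier_cons tau e E :
  unifier tau (e :: E) <->
  aci1 (tsubst tau e.1) (tsubst tau e.2) /\ unifier tau E.
Proof.
split=> [un|[ue uE] e']; last by rewrite inE => /predU1P[->|/uE].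
by split=> [|e' e'E]; apply: un; rewrite inE ?eqxx ?e'E ?orbT.
Qed.

Lemma unifier_cat tau E E' :
  unifier tau (E ++ E') <-> unifier tau E /\ unifier tau E'.
Proof.
split=> [un|[uE uE'] e]; last by rewrite mem_cat => /orP[/uE|/uE'].
by split=> e eE; apply: un; rewrite mem_cat eE ?orbT.
Qed.

Lemma unifier_perm tau E E' :
  perm_eq E E' -> unifier tau E -> unifier tau E'.
Proof. by move=> /perm_mem eqE un e; rewrite -eqE => /un. Qed.

Lemma eq_subst_sys sigma tau E :
  {in vars_sys E, sigma =1 tau} -> subst_sys sigma E = subst_sys tau E.
Proof.
move=> eq_st; apply/eq_in_map => e eE.
by congr pair; apply: tsubst_ext => x xe; apply: eq_st; apply/flatten_mapP;
  exists e; rewrite // mem_cat xe ?orbT.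
Qed.

Lemma unifierE sigma E : unifier sigma E <-> unifier Var (subst_sys sigma E).
Proof.
split=> [un _ /mapP[e /un eqe ->]|un e eE] /=; first by rewrite !tsubst_Var.
by have:= un _ (map_f _ eE); rewrite !tsubst_Var.
Qed.

Lemma eq_unifier sigma tau E :
  {in vars_sys E, sigma =1 tau} -> unifier sigma E <-> unifier tau E.
Proof. by move=> eq_st; rewrite unifierE (eq_subst_sys eq_st) -unifierE. Qed.

Lemma unifier_args tau s t : is_app s -> head_sym s = head_sym t ->
  unifier tau (zip (args s) (args t)) <-> aci1 (tsubst tau s) (tsubst tau t).
Proof.
case: s => // f ts _; case: t => [|| |g us] // -[efg]; subst g.
rewrite zip_args; split=> [un|eq_st _ /mapP[i _ ->]].
  apply: aci1_app => i; rewrite !ffunE.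
  by apply: (un (ts i, us i)); apply: map_f; rewrite mem_enum.
by have:= aci1_app_inj i eq_st; rewrite !ffunE.
Qed.

(* For an idempotent [theta], this says that [tau] is an instance of [theta]
   modulo ACI1. *)
Definition absorbs tau theta : Prop :=
  forall x, aci1 (tsubst tau (theta x)) (tau x).

Lemma absorbs_tsubst tau theta t :
  absorbs tau theta -> aci1 (tsubst tau (tsubst theta t)) (tsubst tau t).
Proof.
by move=> abs; rewrite tsubst_scomp; apply: tsubst_aci1 => x _; apply: abs.
Qed.

Lemma absorbs_subst1 tau x t :
  aci1 (tau x) (tsubst tau t) -> absorbs tau (subst1 x t).
Proof. by move=> xt y; rewrite /subst1; case: eqP => [->|//]; rewrite xt. Qed.

Lemma unifier_subst_sys tau theta E :
  absorbs tau theta -> unifier tau (subst_sys theta E) <-> unifier tau E.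
Proof.
move=> abs; split=> [un e eE|un _ /mapP[e eE ->]] /=.
  by have:= un _ (map_f _ eE); rewrite /= !absorbs_tsubst.
by rewrite !absorbs_tsubst //; apply: un.
Qed.

Lemma absorbs_subst_of tau E : unifier tau E -> absorbs tau (subst_of E).
Proof.
elim: E => [_ x|e E IH /unifier_cons[un1 /IH abs] x] //=.
by case: eqP un1 => [->|//] /= ->.
Qed.

Definition equations (bs : seq (nat * term S)) : system S :=
  [seq (Var b.1, b.2) | b <- bs].

Lemma subst_of_equations bs b :
  uniq (unzip1 bs) -> b \in bs -> subst_of (equations bs) b.1 = b.2.
Proof.
elim: bs => //= c bs IH /andP[c_out uq]; rewrite inE => /predU1P[->|b_in] /=.
  by rewrite eqxx.
rewrite ifN ?IH //; apply: contra c_out => /eqP[->].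
exact: map_f.
Qed.

Lemma subst_of_equations_out bs x :
  x \notin unzip1 bs -> subst_of (equations bs) x = Var x.
Proof.
elim: bs => //= c bs IH /norP[xc /IH->]; rewrite ifN //.
by apply: contraNneq xc => -[->].
Qed.

Lemma solved_form_unifier E : solved_form E -> unifier (subst_of E) E.
Proof.
case=> bs [-> uq fresh] _ /mapP[b b_in ->]; rewrite -/(equations bs) /=.
rewrite subst_of_equations // (tsubst_ext (tau := Var)) ?tsubst_Var // => x xb.
apply: subst_of_equations_out; apply: contraL xb => x_in.
exact: fresh.
Qed.

End Systems.

(** * Elimination of variables *)

Section Elimination.
Variable S : signature.
Implicit Types (theta : subst S) (xs ys W : seq nat).

Definition eliminates theta xs W : Prop :=
  (forall x, x \notin xs -> theta x = Var x) /\
  {in xs, forall x, {subset vars (theta x) <= [seq z <- W | z \notin xs]}}.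

Lemma eliminates_sub theta xs W W' :
  {subset W <= W'} -> eliminates theta xs W -> eliminates theta xs W'.
Proof.
move=> subW [out vals]; split=> // x x_in z /(vals x x_in).
by rewrite !mem_filter => /andP[-> /subW].
Qed.

Lemma vars_eliminates theta xs W ys : eliminates theta xs W ->
  {subset flatten [seq vars (theta y) | y <- ys]
     <= [seq z <- ys ++ W | z \notin xs]}.
Proof.
move=> [out vals] z /flatten_mapP[y y_in]; rewrite mem_filter mem_cat.
have [/vals yz /yz|/[dup] y_out /out->] := boolP (y \in xs).
  by rewrite mem_filter => /andP[-> ->]; rewrite orbT.
by rewrite inE => /eqP->; rewrite y_out y_in.
Qed.

Lemma eliminates_subst1 x t :
  x \notin vars t -> eliminates (subst1 x t) [:: x] (vars t).
Proof.
move=> xt; split=> y; rewrite inE /subst1; first by move/negbTE->.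
move/eqP->; rewrite eqxx => z zt; rewrite mem_filter zt inE andbT.
by apply: contraNneq xt => <-.
Qed.

Variables (bind : nat -> seq nat) (lam : subst S).
Local Notation val := (rhs bind lam).
Local Notation comp := (composition bind lam).

Lemma composition_cons x xs y :
  comp (x :: xs) y = tsubst (comp xs) (subst1 x (val x) y).
Proof.
pose f (rho : subst S) x := scomp rho (subst1 x (val x)).
have fold zs rho z : foldl f rho zs z = tsubst (foldl f Var zs) (rho z).
  elim: zs rho z => [|z' zs IH] rho z /=; first by rewrite tsubst_Var.
  rewrite IH tsubst_scomp; apply: tsubst_ext => w _.
  by rewrite IH.
by rewrite /composition /= fold.
Qed.

Definition triangular xs : Prop :=
  pairwise (fun x y => x \notin vars (val y)) xs /\
  {in xs, forall x, x \notin vars (val x)}.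

Lemma triangular_cons x xs : triangular (x :: xs) ->
  {in x :: xs, forall y, x \notin vars (val y)} /\ triangular xs.
Proof.
case=> /= /andP[/allP xr pw] irr; split; last first.
  by split=> // y yxs; apply: irr; rewrite inE yxs orbT.
by move=> y; rewrite inE => /predU1P[->|/xr//]; apply: irr; rewrite mem_head.
Qed.

Lemma removal_order_triangular l r xs :
  ~ cyclic l r bind lam -> removal_order l r bind lam xs -> triangular xs.
Proof.
move=> acyc [/perm_mem eq_xs pw]; split; last first.
  move=> x; rewrite eq_xs => x_in; apply/negP => xx; apply: acyc.
  by exists x => //; apply: t_step; rewrite /depends x_in.
apply: (sub_in_pairwise (P := mem xs)) pw; last exact/allP.
by move=> x y _ yxs; rewrite /depends -eq_xs (yxs : y \in xs).
Qed.

Lemma composition_eliminates xs : triangular xs ->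
  eliminates (comp xs) xs (flatten [seq vars (val x) | x <- xs]).
Proof.
elim: xs => // x xs IH /triangular_cons[x_out /IH elim_xs].
set W := flatten _; have x_notinW : x \notin W.
  by apply/flatten_mapP => -[y /x_out/negP].
have comp_vars y : y \in x :: xs ->
    {subset vars (val y) <= W}.
  by move=> y_in z zy; apply/flatten_mapP; exists y.
have {elim_xs}elim_xs : eliminates (comp xs) xs W.
  by apply: eliminates_sub elim_xs => z; rewrite /W /= mem_cat orbC => ->.
split=> y; rewrite composition_cons /subst1.
  by rewrite inE negb_or => /andP[/negbTE-> y_out]; apply: elim_xs.1.
move=> y_in z z_in.
suff: z \in [seq z <- W | z \notin xs].
  rewrite !mem_filter inE negb_or => /andP[-> zW]; rewrite zW !andbT.
  by apply: contraNneq x_notinW => <-.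
move: z_in; case: eqP y_in => [_ _|/eqP neq]; last first.
  by rewrite inE (negbTE neq) => y_in; apply: elim_xs.2.
rewrite vars_tsubst => /(vars_eliminates elim_xs).
rewrite !mem_filter mem_cat => /andP[-> /orP[]//].
by apply: comp_vars; apply: mem_head.
Qed.

Lemma composition_fix xs x : triangular xs -> x \in xs ->
  tsubst (comp xs) (val x) = comp xs x.
Proof.
elim: xs x => // x0 xs IH x /triangular_cons[x0_out tri] x_in.
have -> : tsubst (comp (x0 :: xs)) (val x) = tsubst (comp xs) (val x).
  apply: tsubst_ext => y yx; rewrite composition_cons /subst1 ifN //.
  by apply: contraNneq (x0_out x x_in) => <-.
rewrite composition_cons /subst1; case: eqP => [->//|/eqP neq].
by rewrite /= IH //; move: x_in; rewrite inE (negbTE neq).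
Qed.

Lemma absorbs_composition tau xs :
  {in xs, forall x, aci1 (tsubst tau (val x)) (tau x)} -> absorbs tau (comp xs).
Proof.
elim: xs => [_ x //|x xs IH fix_xs y]; rewrite composition_cons.
rewrite absorbs_tsubst; last first.
  by apply: IH => z z_in; apply: fix_xs; rewrite inE z_in orbT.
by apply: absorbs_subst1; rewrite fix_xs ?mem_head.
Qed.

End Elimination.

(** * Invariant of the procedure *)

Section Invariant.
Variable S : signature.
Implicit Types (e : term S * term S) (E : system S) (theta : subst S).
Implicit Types (bs : seq (nat * term S)) (U V xs : seq nat).

Definition value_vars bs : seq nat := flatten [seq vars b.2 | b <- bs].

Definition subst_values theta bs : seq (nat * term S) :=
  [seq (b.1, tsubst theta b.2) | b <- bs].

Definition new U V : seq nat := [seq z <- V | z \notin U].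

Record well_formed U bs E : Prop := WellFormed {
  wf_uniq : uniq (unzip1 bs);
  wf_out : {in unzip1 bs, forall x, x \notin value_vars bs ++ vars_sys E};
  wf_used : {subset unzip1 bs ++ value_vars bs ++ vars_sys E <= U}
}.

Definition invariant (st : state S) : Prop :=
  exists2 bs, solved st = equations bs & well_formed (used st) bs (todo st).

Lemma well_formed_init E : well_formed (vars_sys E) [::] E.
Proof. by split. Qed.

Lemma well_formed_solved_form U bs E :
  well_formed U bs E -> solved_form (equations bs).
Proof.
case=> uq out _; exists bs; split=> // x b x_in b_in.
have := out x x_in; rewrite mem_cat => /norP[+ _]; apply: contra => xb.
by apply/flatten_mapP; exists b.
Qed.

Lemma well_formed_perm U bs bs' E E' : perm_eq bs bs' -> perm_eq E E' ->
  well_formed U bs E -> well_formed U bs' E'.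
Proof.
move=> pbs pE [uq out us].
have p1 : perm_eq (unzip1 bs) (unzip1 bs') by apply: perm_map.
have p2 : perm_eq (value_vars bs ++ vars_sys E) (value_vars bs' ++ vars_sys E').
  by apply: perm_cat (perm_vars_sys pE); apply/perm_flatten/perm_map.
split=> [|x|x]; first by rewrite -(perm_uniq p1).
  by rewrite -(perm_mem p1) -(perm_mem p2); apply: out.
by rewrite -(perm_mem (perm_cat p1 p2)); apply: us.
Qed.

Lemma well_formed_todo U V bs E E' :
  {subset vars_sys E' <= vars_sys E ++ new U V} ->
  well_formed U bs E -> well_formed (V ++ U) bs E'.
Proof.
move=> subE [uq out us]; split=> // x.
  move=> x_in; have := out x x_in; rewrite !mem_cat.
  case/norP=> /negbTE-> xE /=; apply: contra xE => /subE.
  by rewrite mem_cat mem_filter us ?orbF // mem_cat x_in.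
have sub : {subset unzip1 bs ++ value_vars bs ++ vars_sys E'
              <= (unzip1 bs ++ value_vars bs ++ vars_sys E) ++ new U V}.
  move=> z; rewrite !mem_cat => /or3P[->|->|/subE]; rewrite ?orbT //.
  by rewrite mem_cat => /orP[]->; rewrite ?orbT.
by move=> /sub; rewrite !(mem_cat, mem_filter) => /orP[|/andP[_ ->]] //;
  rewrite -!mem_cat => /us; rewrite mem_cat => ->; rewrite orbT.
Qed.

Lemma subst_equations theta bs :
  {in unzip1 bs, theta =1 Var} ->
  subst_sys theta (equations bs) = equations (subst_values theta bs).
Proof.
move=> out; rewrite /subst_sys /equations -!map_comp.
apply/eq_in_map => b b_in /=.
by rewrite out ?map_f.
Qed.

Lemma well_formed_out U bs e E : well_formed U bs (e :: E) ->
  {in unzip1 bs, forall x, x \notin vars e.1 ++ vars e.2}.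
Proof.
case=> _ out _ x /out; rewrite vars_sys_cons [_ \in _ ++ _]mem_cat => /norP[_].
by rewrite mem_cat => /norP[].
Qed.

Lemma subst_equations_eliminate U bs e E xs theta W :
    well_formed U bs (e :: E) -> {subset xs <= vars e.1 ++ vars e.2} ->
    eliminates theta xs W ->
  subst_sys theta (equations bs) = equations (subst_values theta bs).
Proof.
move=> wf xs_e elim_xs; apply: subst_equations => x /(well_formed_out wf) x_out.
by apply: elim_xs.1; apply: contra x_out => /xs_e.
Qed.

Lemma value_vars_subst theta bs :
  value_vars (subst_values theta bs) =
  flatten [seq vars (theta x) | x <- value_vars bs].
Proof.
rewrite /value_vars; elim: bs => //= b bs ->.
by rewrite map_cat flatten_cat vars_tsubst.
Qed.

Lemma vars_eliminate bs e E E2 xs W theta :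
    eliminates theta xs ((vars e.1 ++ vars e.2) ++ W) ->
    {subset vars_sys E2 <=
      [seq z <- (vars e.1 ++ vars e.2) ++ W | z \notin xs]} ->
  {subset
    value_vars (subst_values theta bs ++ [seq (x, theta x) | x <- xs]) ++
      vars_sys (subst_sys theta E ++ E2) <=
    [seq z <- (value_vars bs ++ vars_sys (e :: E)) ++ W | z \notin xs]}.
Proof.
move=> elim_xs E2W z; set Z := value_vars _ ++ vars_sys (_ ++ _).
have -> : Z = flatten [seq vars (theta x) |
    x <- value_vars bs ++ xs ++ vars_sys E] ++ vars_sys E2.
  rewrite !map_cat !flatten_cat -vars_subst_sys -value_vars_subst -!catA.
  by rewrite -vars_sys_cat catA /Z /value_vars map_cat flatten_cat -!map_comp.
rewrite mem_cat => /orP[/(vars_eliminates elim_xs)|/E2W];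
  rewrite !mem_filter => /andP[z_out]; rewrite z_out vars_sys_cons !mem_cat;
  by rewrite ?(negbTE z_out); do !case: (z \in _).
Qed.

Lemma well_formed_eliminate U V bs e E E2 xs theta :
    let W := (vars e.1 ++ vars e.2) ++ new U V in
    well_formed U bs (e :: E) -> uniq xs ->
    {subset xs <= vars e.1 ++ vars e.2} -> eliminates theta xs W ->
    {subset vars_sys E2 <= [seq z <- W | z \notin xs]} ->
  well_formed (V ++ U)
    (subst_values theta bs ++ [seq (x, theta x) | x <- xs])
    (subst_sys theta E ++ E2).
Proof.
move=> W wf uxs xs_e elim_xs E2W.
set bs' := subst_values theta bs ++ _; set E' := _ ++ E2.
have [uq out us] := wf; have out_e := well_formed_out wf.
have lhs : unzip1 bs' = unzip1 bs ++ xs.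
  by rewrite /unzip1 map_cat -!map_comp (map_id xs).
have vals : {subset value_vars bs' ++ vars_sys E' <=
    [seq z <- (value_vars bs ++ vars_sys (e :: E)) ++ new U V | z \notin xs]}
  := vars_eliminate elim_xs E2W.
have lhs_used x : x \in unzip1 bs -> x \in U.
  by move=> x_in; apply: us; rewrite mem_cat x_in.
split; rewrite lhs.
- rewrite cat_uniq uq uxs andbT; apply/hasPn => x /xs_e x_e /=.
  by apply: contraL x_e => /out_e.
- move=> x; rewrite mem_cat => /orP[x_in|x_in]; apply/negP => /vals; last first.
    by rewrite mem_filter x_in.
  rewrite mem_filter mem_cat (negbTE (out x x_in)) mem_filter.
  by rewrite lhs_used ?andbF.
- move=> x; rewrite -catA mem_cat => /orP[/lhs_used xU|].
    by rewrite mem_cat xU orbT.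
  rewrite mem_cat => /orP[/xs_e x_e|/vals].
    by rewrite mem_cat us ?orbT // vars_sys_cons 3!mem_cat x_e !orbT.
  rewrite mem_filter mem_cat [_ \in V ++ U]mem_cat => /andP[_ /orP[x_in|]].
    by rewrite us ?orbT // mem_cat x_in orbT.
  by rewrite mem_filter => /andP[_ ->].
Qed.

End Invariant.

(** * A single ACI1 step *)

Section AciStep.
Variables (S : signature) (U : seq nat) (l r : term S).
Variables (NL NR : seq nat) (bind : nat -> seq nat) (lam : subst S).
Implicit Types (t u : term S) (tau delta : subst S) (p : term S * seq nat).

Local Notation names := (zip (app_members l ++ app_members r) (NL ++ NR)).
Local Notation E2 := (named_bindings l r NL NR bind).
Local Notation unknowns := ((NL ++ NR) ++ step_vars l r).

Lemma mem_step_vars x :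
  (x \in step_vars l r) = (x \in var_members l) || (x \in var_members r).
Proof. by rewrite mem_undup mem_cat. Qed.

Lemma vars_step_vars : {subset step_vars l r <= vars l ++ vars r}.
Proof.
move=> x; rewrite mem_step_vars mem_cat.
by case/orP=> /vars_var_members->; rewrite ?orbT.
Qed.

Lemma named_bindingP p :
  p \in E2 <-> exists2 x, (p.1, x) \in names & p.2 = bind x.
Proof.
rewrite /named_bindings; move: (_ ++ _) (_ ++ _) => N A.
have -> : zip A [seq bind x | x <- N] = [seq (q.1, bind q.2) | q <- zip A N].
  by elim: A N => [|a A IH] [|n N] //=; rewrite IH.
case: p => u xs; split=> [/mapP[[v x] vx [-> ->]]|/= [x ux ->]].
  by exists x.
exact: (map_f (fun q => (q.1, bind q.2)) ux).
Qed.

Lemma named_binding_unknown p :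
  p \in E2 -> exists2 x, x \in unknowns & p.2 = bind x.
Proof.
case/named_bindingP=> x /mem_zip[_ /= xN] ->; exists x => //.
by rewrite mem_cat xN.
Qed.

Lemma named_binding_app p :
  p \in E2 -> is_app p.1 /\ {subset vars p.1 <= vars l ++ vars r}.
Proof.
case/mem_zip; rewrite mem_cat => /orP[]/app_memberP[p_app pv] _;
  by split=> // x /pv; rewrite mem_cat => ->; rewrite ?orbT.
Qed.

Lemma normalization_aci1 tau delta N t : size N = size (app_members t) ->
    (forall u x, (u, x) \in zip (app_members t) N ->
       aci1 (delta x) (tsubst tau u)) ->
    {in var_members t, forall x, aci1 (delta x) (tau x)} ->
  aci1 (tsubst delta (vunion S (N ++ var_members t))) (tsubst tau t).
Proof.
move=> sz_N eqN eqV; apply: aci_le_anti.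
  apply/le_vunion => x; rewrite mem_cat => /orP[x_in|x_in]; last first.
    rewrite eqV //; apply: (member_tsubst_le tau (u := Var x)).
    by rewrite -mem_var_members.
  have: x \in unzip2 (zip (app_members t) N) by rewrite unzip2_zip ?sz_N.
  case/mapP=> -[u y] ux /= ->; rewrite (eqN _ _ ux); apply: member_tsubst_le.
  by case: (mem_zip ux) => /=; rewrite mem_filter => /andP[].
apply/le_tsubst_members => u ut; have /orP[u_var|u_app] := mem_members_atom ut.
  case: u u_var ut => // x _; rewrite -mem_var_members => x_in.
  rewrite -[tsubst _ _]/(tau x) -eqV //; apply: mem_vunion_le.
  by rewrite mem_cat x_in orbT.
have: u \in unzip1 (zip (app_members t) N).
  by rewrite unzip1_zip ?sz_N // mem_filter u_app.
case/mapP=> -[v x] vx /= ->; rewrite -(eqN _ _ vx); apply: mem_vunion_le.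
by rewrite mem_cat (mem_zip vx).2.
Qed.

Lemma le_rhs tau x t :
  aci_le (tsubst tau (rhs bind lam x)) t <->
  (forall a, a \in bind x -> aci_le (tsubst tau (lam a)) t).
Proof. by rewrite /rhs tsubst_scomp le_vunion. Qed.

Lemma mem_rhs_le tau x a :
  a \in bind x -> aci_le (tsubst tau (lam a)) (tsubst tau (rhs bind lam x)).
Proof. by move: a; apply/le_rhs/aci_le_refl. Qed.

Lemma mem_propagated p u :
  u \in propagated lam p <-> u != Empty /\ exists2 a, a \in p.2 & u = lam a.
Proof.
rewrite mem_undup mem_filter; split=> [/andP[-> /mapP]//|[-> [a ap ->]]].
exact: map_f.
Qed.

Lemma le_rhs_propagated tau u x t :
  aci_le (tsubst tau (rhs bind lam x)) t <->
  (forall v, v \in propagated lam (u, bind x) -> aci_le (tsubst tau v) t).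
Proof.
rewrite le_rhs; split=> [le v /mem_propagated[_ [a ax ->]]|le a ax].
  exact: le.
have [->|a0] := eqVneq (lam a) Empty; first exact: aci_le0.
by apply/le/mem_propagated; split=> //; exists a.
Qed.

Section Solution.
Hypothesis es : elementary_solution U l r NL NR bind.

Lemma bind_fresh x a : x \in unknowns -> a \in bind x -> a \notin U.
Proof.
move=> x_in ax.
have: a \notin U ++ NL ++ NR; last by rewrite mem_cat => /norP[].
apply: (es_fresh es) ax; move: x_in.
by rewrite !mem_cat mem_step_vars => /orP[]/orP[]->; rewrite ?orbT.
Qed.

Lemma normalization_sides tau delta :
    (forall u x, (u, x) \in names -> aci1 (delta x) (tsubst tau u)) ->
    {in step_vars l r, forall x, aci1 (delta x) (tau x)} ->
  aci1 (tsubst delta (vunion S (NL ++ var_members l))) (tsubst tau l) /\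
  aci1 (tsubst delta (vunion S (NR ++ var_members r))) (tsubst tau r).
Proof.
case: es => szL szR _ _ _ _; rewrite zip_cat // => eqN eqV.
split; apply: normalization_aci1 => // [u x ux|x x_in].
- by apply: eqN; rewrite mem_cat ux.
- by apply: eqV; rewrite mem_step_vars x_in.
- by apply: eqN; rewrite mem_cat ux orbT.
- by apply: eqV; rewrite mem_step_vars x_in orbT.
Qed.

Hypothesis prop : propagation E2 lam.

Lemma propagationP a :
  [\/ lam a = Var a /\ {in E2, forall p, a \notin p.2},
      lam a = Empty |
      exists p, [/\ p \in E2, a \in p.2 & lam a = p.1]].
Proof.
move: (prop a); case Ef: [seq p <- _ | _] => [|p ps].
  move=> lam_a; constructor 1; split=> // p pE; apply/negP => ap.
  have: p \in [seq p <- E2 | a \in p.2] by rewrite mem_filter ap.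
  by rewrite Ef.
case=> lam_a; [by constructor 2 | constructor 3; exists p].
have: p \in [seq p <- E2 | a \in p.2] by rewrite Ef mem_head.
by rewrite mem_filter => /andP[].
Qed.

Lemma vars_rhs y z : z \in vars (rhs bind lam y) ->
  z \in vars l ++ vars r \/ z \in bind y.
Proof.
rewrite vars_tsubst vars_vunion => /flatten_mapP[a ay].
case: (propagationP a) => [[-> _]|->|[p [pE _ ->]]] //.
  by rewrite inE => /eqP->; right.
by have [_ pv] := named_binding_app pE; left; apply: pv.
Qed.

Lemma vars_argument_system :
  {subset vars_sys (argument_system E2 lam) <= vars l ++ vars r}.
Proof.
move=> z /flatten_mapP[e /flatten_mapP[p pE /flatten_mapP[u up eu]] ze].
have [_ pv] := named_binding_app pE.
have: z \in vars p.1 ++ vars u.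
  by apply: vars_zip_args; apply/flatten_mapP; exists e.
rewrite mem_cat => /orP[/pv//|].
have [_ [a ap ->]] := (mem_propagated p u).1 up.
case: (propagationP a) => [[_ /(_ p pE)]|->|[q [qE _ ->]]] //.
  by rewrite ap.
by have [_ qv] := named_binding_app qE; apply: qv.
Qed.

Lemma vars_rhs_new y : y \in step_vars l r ->
  {subset vars (rhs bind lam y) <= (vars l ++ vars r) ++
     new U ((NL ++ NR) ++ flatten [seq bind x | x <- unknowns])}.
Proof.
move=> y_in z /vars_rhs zP; rewrite mem_cat; case: zP => [->//|zy].
have y_unk : y \in unknowns by rewrite mem_cat y_in orbT.
apply/orP; right; rewrite mem_filter (bind_fresh y_unk zy) mem_cat.
by apply/orP; right; apply/flatten_mapP; exists y.
Qed.

Hypothesis acc : accepted E2 lam.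

Lemma accepted_head p u :
  p \in E2 -> u \in propagated lam p -> head_sym p.1 = head_sym u.
Proof. by move=> /(allP acc)/andP[_ /allP hd] /hd/eqP. Qed.

Lemma propagated_aci1 tau p u : unifier tau (argument_system E2 lam) ->
  p \in E2 -> u \in propagated lam p -> aci1 (tsubst tau u) (tsubst tau p.1).
Proof.
move=> unA pE up; have [p_app _] := named_binding_app pE; symmetry.
apply/(unifier_args tau p_app (accepted_head pE up)) => e eu.
by apply: unA; apply/flatten_mapP; exists p => //; apply/flatten_mapP; exists u.
Qed.

Lemma rhs_name_aci1 tau u x : unifier tau (argument_system E2 lam) ->
  (u, x) \in names -> aci1 (tsubst tau (rhs bind lam x)) (tsubst tau u).
Proof.
move=> unA ux; have pE : (u, bind x) \in E2 by apply/named_bindingP; exists x.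
have eq_prop v : v \in propagated lam (u, bind x) ->
  aci1 (tsubst tau v) (tsubst tau u) := propagated_aci1 unA pE.
apply: aci_le_anti; first by apply/(le_rhs_propagated tau u) => v /eq_prop->.
have /andP[+ _] := allP acc _ pE; case Ep: (propagated _ _) => [|v vs] // _.
have v_in : v \in propagated lam (u, bind x) by rewrite Ep mem_head.
rewrite -(eq_prop v v_in); move: v v_in {Ep eq_prop}.
exact/(le_rhs_propagated tau u)/aci_le_refl.
Qed.

Lemma aci_step_unifies tau :
    {in step_vars l r, forall x, aci1 (tsubst tau (rhs bind lam x)) (tau x)} ->
    unifier tau (argument_system E2 lam) ->
  aci1 (tsubst tau l) (tsubst tau r).
Proof.
move=> fix_vars unA; pose delta x := tsubst tau (rhs bind lam x).
have [<- <-] := normalization_sides (fun u x => rhs_name_aci1 unA) fix_vars.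
have [un _] := es_mgu es.
have:= un _ (mem_head _ _); move/(aci1_subst lam)/(aci1_subst tau).
by rewrite !(tsubst_scomp _ lam) !(tsubst_scomp _ tau).
Qed.

End Solution.
End AciStep.

(** * Correctness *)

Section Correctness.
Variable S : signature.
Implicit Types (s t : term S) (tau theta : subst S).
Implicit Types (e : term S * term S) (E Es : system S) (st : state S).
Implicit Types U V : seq nat.

Lemma unifier_decompose tau s t :
    ~~ is_var s -> ~~ is_var t -> ~~ is_union s -> ~~ is_union t ->
    head_sym s = head_sym t ->
  unifier tau (zip (args s) (args t)) <-> aci1 (tsubst tau s) (tsubst tau t).
Proof.
have [/unifier_args un _ _ _ _|s_napp] := boolP (is_app s); first exact: un.
by case: s s_napp => // _ _; case: t.
Qed.

Lemma top_occurs_aci1 tau x t : x \in var_members t ->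
  aci1 (tau x) (tsubst tau t) <->
  aci_le (tsubst tau (bigU (other_members (Var x) t))) (tau x).
Proof.
rewrite mem_var_members => /member_aci1/(aci1_subst tau) /= ->.
by rewrite aci1_unionC /aci_le; split=> ?; symmetry.
Qed.

Definition solves tau st : Prop :=
  unifier tau (solved st) /\ unifier tau (todo st).

Lemma solves_eliminate tau U Es E x t :
  solves tau (State U ((Var x, t) :: subst_sys (subst1 x t) Es)
                      (subst_sys (subst1 x t) E)) <->
  solves tau (State U Es ((Var x, t) :: E)).
Proof.
rewrite /solves /= !unifier_cons /=.
by split=> [[[un unEs] unE]|[unEs [un unE]]]; have abs := absorbs_subst1 un;
  rewrite !unifier_subst_sys // in unEs unE *.
Qed.

Lemma aci_step_solves U Es E l r V E1 E2 rho tau :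
    aci_step U l r (Some (V, E1, E2, rho)) ->
    unifier tau (subst_sys rho Es ++ E1) ->
    unifier tau (subst_sys rho E ++ E2) ->
  solves tau (State U Es ((l, r) :: E)).
Proof.
move Eo: (Some _) => o step; case: step Eo => //.
move=> NL NR bind lam xs es prop acc acyc ord rho' [_ -> -> ->].
have tri := removal_order_triangular acyc ord; case: ord => pxs _.
have rho_fix x : x \in step_vars l r -> tsubst rho' (rhs bind lam x) = rho' x.
  by move=> x_in; rewrite composition_fix ?(perm_mem pxs).
move=> /unifier_cat[unEs un1] /unifier_cat[unE unA].
have abs : absorbs tau rho'.
  move=> x; have [x_in|x_out] := boolP (x \in step_vars l r); last first.
    by rewrite [rho' x](composition_eliminates tri).1 ?(perm_mem pxs).
  rewrite -rho_fix //; symmetry.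
  exact: un1 (map_f (fun x => (Var x, tsubst rho' (rhs bind lam x))) x_in).
rewrite !unifier_subst_sys // in unEs unE unA; split=> //.
apply/unifier_cons; split=> //; apply: (aci_step_unifies es acc) unA => x x_in.
by rewrite -(absorbs_tsubst _ abs) rho_fix.
Qed.

Lemma act_solves U Es E e st tau :
  act U Es E e (Some st) -> solves tau st -> solves tau (State U Es (e :: E)).
Proof.
move Eo: (Some _) => o step; case: step Eo => //.
- by move=> x [->] [unEs unE]; split=> //; apply/unifier_cons.
- move=> t x _ [->] [unEs /unifier_cons[un1 unE]]; split=> //.
  by apply/unifier_cons; split=> //; symmetry.
- by move=> x t _ [->] /solves_eliminate.
- move=> x t n _ xt _ _ [->] [unEs /unifier_cons[/= un1 unE]]; split=> //.
  apply/unifier_cons; split=> //; apply/top_occurs_aci1 => //.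
  by rewrite un1; apply: aci_leUl.
- move=> s t sV tV sU tU hst [->] [unEs /unifier_cat[unA unE]]; split=> //.
  by apply/unifier_cons; split=> //; apply/unifier_decompose.
- move=> l r V E1 E2 theta _ _ _ astep [->] [/= + +].
  exact: aci_step_solves astep.
Qed.

Lemma aci_step_invariant U bs E l r V E1 E2 rho :
    aci_step U l r (Some (V, E1, E2, rho)) -> well_formed U bs ((l, r) :: E) ->
  invariant (State (V ++ U) (subst_sys rho (equations bs) ++ E1)
                            (subst_sys rho E ++ E2)).
Proof.
move Eo: (Some _) => o step; case: step Eo => //.
move=> NL NR bind lam xs es prop acc acyc ord rho'.
move=> [-> -> -> ->] wf {V E1 E2 rho}.
have tri := removal_order_triangular acyc ord; case: ord => /perm_mem mem_xs _.
set V := (NL ++ NR) ++ _; set W := (vars l ++ vars r) ++ new U V.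
have elim_rho : eliminates rho' (step_vars l r) W.
  have [out vals] : eliminates rho' xs W.
    apply: eliminates_sub (composition_eliminates tri) => z /flatten_mapP[y].
    by rewrite mem_xs => y_in; apply: (vars_rhs_new es prop).
  split=> x; rewrite -mem_xs; [exact: out | move=> /vals x_in z /x_in].
  by rewrite !mem_filter mem_xs.
have subE := subst_equations_eliminate wf (@vars_step_vars _ _ _) elim_rho.
exists (subst_values rho' bs ++ [seq (x, rho' x) | x <- step_vars l r]) => /=.
  rewrite subE /equations map_cat; congr (_ ++ _).
  rewrite -map_comp; apply/eq_in_map => x x_in /=.
  by rewrite composition_fix ?mem_xs.
apply: (well_formed_eliminate wf) => //; first exact: undup_uniq.
  exact: vars_step_vars.
move=> z; rewrite vars_subst_sys => /(vars_eliminates elim_rho).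
rewrite !mem_filter mem_cat => /andP[-> /orP[|//]].
by move=> /(vars_argument_system prop) z_in; rewrite mem_cat z_in.
Qed.

Lemma invariant_todo U V Es E E' :
  {subset vars_sys E' <= vars_sys E ++ new U V} ->
  invariant (State U Es E) -> invariant (State (V ++ U) Es E').
Proof.
by move=> subE [bs /= -> wf]; exists bs => //=; apply: well_formed_todo wf.
Qed.

Lemma invariant_perm U Es E E' : perm_eq E E' ->
  invariant (State U Es E) -> invariant (State U Es E').
Proof.
by move=> pE [bs eqs wf]; exists bs => //; apply: well_formed_perm wf.
Qed.

Lemma invariant_eliminate U Es E x t : x \notin vars t ->
  invariant (State U Es ((Var x, t) :: E)) ->
  invariant (State U ((Var x, t) :: subst_sys (subst1 x t) Es)
                     (subst_sys (subst1 x t) E)).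
Proof.
move=> xt [bs /= -> wf].
pose W := (vars (Var x : term S) ++ vars t) ++ new U [::].
have elim_x : eliminates (subst1 x t) [:: x] W.
  apply: eliminates_sub (eliminates_subst1 xt) => y yt.
  by rewrite !mem_cat yt orbT.
have x_sub : {subset [:: x] <= vars (Var x : term S) ++ vars t}.
  by move=> y; rewrite inE => /eqP->; apply: mem_head.
exists ((x, t) :: subst_values (subst1 x t) bs) => /=.
  by rewrite (subst_equations_eliminate wf x_sub elim_x).
have := well_formed_eliminate (E2 := [::]) (V := [::]) wf
  (erefl : uniq [:: x]) x_sub elim_x.
rewrite cats0 /= /subst1 eqxx => wf'; apply: well_formed_perm (wf' _) => //.
by rewrite cats1 perm_rcons.
Qed.

Lemma act_invariant U Es E e st :
  act U Es E e (Some st) -> invariant (State U Es (e :: E)) -> invariant st.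
Proof.
move Eo: (Some _) => o step; case: step Eo => //.
- move=> x [->]; apply: (invariant_todo (V := [::])) => y.
  by rewrite cats0 vars_sys_cons mem_cat => ->; rewrite orbT.
- move=> t x _ [->]; apply: (invariant_todo (V := [::])) => y.
  by rewrite cats0 !vars_sys_cons /= !(mem_cat, inE) orbA (orbC (y == x)).
- by move=> x t xt [->]; apply: invariant_eliminate.
- move=> x t n _ xt _ nU [->]; apply: (invariant_todo (V := [:: n])) => y.
  rewrite !vars_sys_cons /= nU !(mem_cat, inE).
  case: eqP => //= _.
  by case/orP=> [/orP[/vars_bigU_other->|->]|->]; rewrite ?orbT.
- move=> s t _ _ _ _ _ [->]; apply: (invariant_todo (V := [::])) => y.
  rewrite cats0 vars_sys_cat vars_sys_cons !mem_cat.
  by case/orP=> [/vars_zip_args|->]; rewrite ?orbT // mem_cat => ->.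
- move=> l r V E1 E2 theta _ _ _ astep [->] [bs /= -> wf].
  exact: aci_step_invariant astep wf.
Qed.

Lemma vars_equations (bs : seq (nat * term S)) :
  {subset vars_sys (equations bs) <= unzip1 bs ++ value_vars bs}.
Proof.
move=> x /flatten_mapP[_ /mapP[b b_in ->] /=]; rewrite inE mem_cat.
case/predU1P=> [->|xb]; first by rewrite map_f.
by apply/orP; right; apply/flatten_mapP; exists b.
Qed.

Lemma invariant_used U Es e E : invariant (State U Es (e :: E)) ->
  [/\ {subset vars_sys Es <= U}, {subset vars e.1 ++ vars e.2 <= U} &
      {subset vars_sys E <= U}].
Proof.
case=> bs /= -> [_ _ us].
split=> x x_in; apply: us; rewrite vars_sys_cons catA mem_cat.
- by rewrite (vars_equations x_in).
- by rewrite [X in _ || X]mem_cat x_in orbT.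
- by rewrite [X in _ || X]mem_cat x_in !orbT.
Qed.

Lemma act_used U Es E e st : act U Es E e (Some st) -> {subset U <= used st}.
Proof.
move Eo: (Some _) => o step; case: step Eo => //.
- by move=> x [->].
- by move=> t x _ [->].
- by move=> x t _ [->].
- by move=> x t n _ _ _ _ [->] y yU; rewrite inE yU orbT.
- by move=> s t _ _ _ _ _ [->].
- by move=> l r V E1 E2 theta _ _ _ _ [->] y yU; rewrite mem_cat yU orbT.
Qed.

Lemma branch_sound st Es : branch st Es -> invariant st ->
  solved_form Es /\ (forall tau, unifier tau Es -> solves tau st).
Proof.
elim=> {st Es} [U Es [bs /= -> wf]|st st' Es + _ IH].
  by split=> [|tau un]; [apply: well_formed_solved_form wf | split].
move Eo: (Some st') => o step.
case: step Eo => U Es' E E' e {}o step eo; rewrite -{}eo in step => inv.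
have pE : perm_eq (E ++ e :: E') (e :: E ++ E') by rewrite -cat1s perm_catCA.
have [sol un] := IH (act_invariant step (invariant_perm pE inv)).
split=> // tau /un/(act_solves step)[unEs unE]; split=> //.
by apply: unifier_perm unE; rewrite perm_sym.
Qed.

End Correctness.

(** * Elementary unification *)

Section Elementary.
Variable S : signature.
Implicit Types (s t u m : term S) (sigma : subst S) (P Q U : seq nat).

Definition meet s t : term S :=
  bigU [seq m <- members s | excluded_middle_informative (aci_le m t) : bool].

Lemma atom_le_meet m s t : is_atom m ->
  aci_le m (meet s t) <-> aci_le m s /\ aci_le m t.
Proof.
move=> m_atom; have mem_meet u :
    u \in members (meet s t) <-> u \in members s /\ aci_le u t.
  rewrite members_bigU_filter mem_filter.
  by case: excluded_middle_informative => le_ut /=; split=> [|[]].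
rewrite !(atom_leP _ m_atom); split=> [[u /mem_meet[us ut] mu]|[[u us mu] mt]].
  by split; [exists u | apply/(atom_leP _ m_atom); rewrite mu].
exists u => //; apply/mem_meet; split=> //.
by rewrite -mu; apply/(atom_leP _ m_atom).
Qed.

Definition pair_name (K p q : nat) : nat := K + pickle (p, q).

(* The variable named by (p, q) stands for the intersection of the values of
   p and q, so p and q are both bound to unions involving it. *)
Definition pair_bind (K : nat) P Q (x : nat) : seq nat :=
  (if x \in P then [seq pair_name K x q | q <- Q] else [::]) ++
  (if x \in Q then [seq pair_name K p x | p <- P] else [::]).

Lemma pair_bindP K P Q x a :
  a \in pair_bind K P Q x <->
  exists p q, [/\ p \in P, q \in Q, a = pair_name K p q & x = p \/ x = q].
Proof.
rewrite mem_cat; split=> [/orP[]|[p [q [pP qQ -> []->]]]].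
- by case: ifP => // xP /mapP[q qQ ->]; exists x, q; split=> //; left.
- by case: ifP => // xQ /mapP[p pP ->]; exists p, x; split=> //; right.
- by rewrite pP map_f.
- by rewrite qQ (map_f (fun p => pair_name K p q)) ?orbT.
Qed.

Lemma pair_bind_unifies K P Q :
  unifier (fun x => vunion S (pair_bind K P Q x)) [:: (vunion S P, vunion S Q)].
Proof.
set theta := fun x => _.
have le_side ys x : (forall p q, p \in P -> q \in Q -> p \in ys \/ q \in ys) ->
    aci_le (theta x) (tsubst theta (vunion S ys)).
  move=> meets; rewrite -[theta x]tsubst_Var; apply/le_vunion => a.
  case/pair_bindP=> p [q [pP qQ -> _]].
  suff [y y_in ay] :
      exists2 y, y \in ys & pair_name K p q \in pair_bind K P Q y.
    apply: aci_le_trans (mem_vunion_le theta y_in).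
    by rewrite -[theta y]tsubst_Var; apply: mem_vunion_le ay.
  by case: (meets p q pP qQ) => y_in; [exists p | exists q] => //;
    apply/pair_bindP; exists p, q; split=> //; [left | right].
move=> e; rewrite inE => /eqP-> /=; apply: aci_le_anti;
  apply/le_vunion => x _; apply: le_side => p q; by [right | left].
Qed.

Lemma pair_bind_mgu K P Q :
  mgu (fun x => vunion S (pair_bind K P Q x)) [:: (vunion S P, vunion S Q)].
Proof.
split=> [|sigma /(_ _ (mem_head _ _)) /= unS]; first exact: pair_bind_unifies.
pose lambda a :=
  if unpickle (a - K) is Some (p, q) then meet (sigma p) (sigma q) else Empty.
have lambdaE p q : lambda (pair_name K p q) = meet (sigma p) (sigma q).
  by rewrite /lambda /pair_name addKn pickleK.
exists lambda => x; rewrite vars_sys_cons cats0 mem_cat !vars_vunion => xPQ.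
apply: aci1_atom_ext => m m_atom; rewrite atom_le_vunion //.
split=> [mx|[a /pair_bindP[p [q [_ _ -> xpq]]]]]; last first.
  by rewrite lambdaE atom_le_meet // => -[mp mq]; case: xpq => ->.
suff [p [q [pP qQ xpq [mp mq]]]] : exists p q,
    [/\ p \in P, q \in Q, x = p \/ x = q &
        aci_le m (sigma p) /\ aci_le m (sigma q)].
  exists (pair_name K p q); first by apply/pair_bindP; exists p, q.
  by rewrite lambdaE; apply/atom_le_meet.
case/orP: xPQ => x_in.
  have [|q qQ mq] := (atom_le_vunion sigma Q m_atom).1.
    by rewrite -unS; apply: aci_le_trans mx (mem_vunion_le _ x_in).
  by exists x, q; split=> //; left.
have [|p pP mp] := (atom_le_vunion sigma P m_atom).1.
  by rewrite unS; apply: aci_le_trans mx (mem_vunion_le _ x_in).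
by exists p, x; split=> //; right.
Qed.

Definition fresh U : nat := (\max_(y <- U) y).+1.

Lemma notin_ge_fresh U x : fresh U <= x -> x \notin U.
Proof.
move=> lt_x; apply: contraL lt_x => xU.
by rewrite -leqNgt (leq_bigmax_seq _ xU).
Qed.

Lemma elementary_solution_exists U (l r : term S) :
  exists NL NR bind, elementary_solution U l r NL NR bind.
Proof.
pose nL := size (app_members l); pose nR := size (app_members r).
pose K := fresh U + (nL + nR).
exists (iota (fresh U) nL), (iota (fresh U + nL) nR).
exists (pair_bind K (iota (fresh U) nL ++ var_members l)
                    (iota (fresh U + nL) nR ++ var_members r)).
split; rewrite ?size_iota -?iotaD ?iota_uniq //.
- by move=> x; rewrite mem_iota => /andP[/notin_ge_fresh].
- move=> x a _ /pair_bindP[p [q [_ _ -> _]]]; rewrite mem_cat negb_or.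
  have leK : K <= pair_name K p q by apply: leq_addr.
  rewrite mem_iota negb_and -!ltnNge ltnS leK orbT andbT.
  by apply: notin_ge_fresh; apply: leq_trans leK; apply: leq_addr.
- exact: pair_bind_mgu.
Qed.

End Elementary.

(** * Completeness of a single ACI1 step *)

Section GuidedStep.
Variables (S : signature) (U : seq nat) (l r : term S) (sigma : subst S).
Variables (NL NR : seq nat) (bind : nat -> seq nat).
Hypothesis lr_used : {subset vars l ++ vars r <= U}.
Hypothesis unify_lr : aci1 (tsubst sigma l) (tsubst sigma r).
Hypothesis es : elementary_solution U l r NL NR bind.

Local Notation names := (zip (app_members l ++ app_members r) (NL ++ NR)).
Local Notation E2 := (named_bindings l r NL NR bind).
Local Notation unknowns := ((NL ++ NR) ++ step_vars l r).

Lemma elementary_instance : exists lambda : subst S,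
  (forall u x, (u, x) \in names ->
     aci1 (tsubst sigma u) (tsubst lambda (vunion S (bind x)))) /\
  {in step_vars l r, forall x,
     aci1 (sigma x) (tsubst lambda (vunion S (bind x)))}.
Proof.
have [_ _ uq notin_U _ [_ gen]] := es; set N := NL ++ NR in uq notin_U *.
pose sigmaN x := if x \in N then
    tsubst sigma (nth Empty (app_members l ++ app_members r) (index x N))
  else sigma x.
have sigmaN_name u x : (u, x) \in names -> sigmaN x = tsubst sigma u.
  by move=> ux; rewrite /sigmaN (mem_zip ux).2 (nth_index_zip _ uq ux).
have sigmaN_var x : x \in step_vars l r -> sigmaN x = sigma x.
  move=> /vars_step_vars/lr_used xU; rewrite /sigmaN ifN //.
  by apply: contraL xU => /notin_U.
have [lambda gen_lambda] :
    more_general unknowns (fun x => vunion S (bind x)) sigmaN.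
  have [|lambda gen_lambda] := gen sigmaN.
    move=> e; rewrite inE => /eqP-> /=.
    have [u x /sigmaN_name->//|x /sigmaN_var->//|-> ->//] :=
      normalization_sides es (tau := sigma) (delta := sigmaN).
  exists lambda => x x_in; apply: gen_lambda.
  rewrite vars_sys_cons cats0 !vars_vunion; move: x_in.
  by rewrite !mem_cat mem_step_vars; do !case: (x \in _).
exists lambda; split=> [u x ux|x x_in].
  rewrite -(sigmaN_name u x ux); apply: gen_lambda.
  by rewrite mem_cat (mem_zip ux).2.
by rewrite -sigmaN_var //; apply: gen_lambda; rewrite mem_cat x_in orbT.
Qed.

Variable lambda : subst S.
Hypothesis lambda_name : forall u x, (u, x) \in names ->
  aci1 (tsubst sigma u) (tsubst lambda (vunion S (bind x))).
Hypothesis lambda_var : {in step_vars l r, forall x,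
  aci1 (sigma x) (tsubst lambda (vunion S (bind x)))}.

Definition guided_lam : subst S := fun a =>
  match [seq p <- E2 | a \in p.2] with
  | [::] => Var a
  | p :: _ => if members (lambda a) is [::] then Empty else p.1
  end.

Definition guided_ext : subst S :=
  fun x => if x \in U then sigma x else lambda x.

Local Notation lam := guided_lam.
Local Notation tau := guided_ext.

Lemma guided_propagation : propagation E2 lam.
Proof.
move=> a; rewrite /guided_lam; case: [seq p <- E2 | _] => // p _.
by case: (members _); [left | right].
Qed.

Lemma guided_ext_used : {in U, tau =1 sigma}.
Proof. by move=> x xU; rewrite /guided_ext xU. Qed.

Lemma guided_binding p : p \in E2 ->
  [/\ is_app p.1, tsubst tau p.1 = tsubst sigma p.1 &
      aci1 (tsubst sigma p.1) (tsubst lambda (vunion S p.2))].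
Proof.
move=> pE; have [p_app pv] := named_binding_app pE; split=> //.
  by apply: tsubst_ext => x /pv/lr_used/guided_ext_used.
by have /named_bindingP[x ux ->] := pE; apply: lambda_name.
Qed.

Lemma guided_binding_atom p : p \in E2 -> is_atom (tsubst tau p.1).
Proof.
by case/guided_binding=> p_app _ _; rewrite /is_atom is_app_tsubst ?orbT.
Qed.

Lemma guided_binding_le p a : p \in E2 -> a \in p.2 ->
  aci_le (lambda a) (tsubst tau p.1).
Proof. by move=> /guided_binding[_ -> ->]; apply: mem_vunion_le. Qed.

(* A value below a single member is empty or that member, so propagation loses
   nothing. *)
Lemma guided_lam_aci1 a x :
  x \in unknowns -> a \in bind x -> aci1 (tsubst tau (lam a)) (lambda a).
Proof.
move=> x_in ax; rewrite /guided_lam; case Ef: [seq p <- E2 | _] => [|p ps].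
  by rewrite /= /guided_ext ifN //; apply: (bind_fresh es x_in ax).
have: p \in [seq p <- E2 | a \in p.2] by rewrite Ef mem_head.
rewrite mem_filter => /andP[ap pE].
case Ea: (members (lambda a)) => [|m ms]; first by rewrite (members0_aci1 Ea).
have [a0|->//] := le_atom (guided_binding_atom pE) (guided_binding_le pE ap).
have m_in : m \in members (lambda a) by rewrite Ea mem_head.
by case: (atom_le0 (mem_members_atom m_in)); rewrite -a0; apply: member_le.
Qed.

Lemma guided_rhs x : x \in unknowns ->
  aci1 (tsubst tau (rhs bind lam x)) (tsubst lambda (vunion S (bind x))).
Proof.
move=> x_in; rewrite /rhs tsubst_scomp; apply: tsubst_aci1 => a.
by rewrite vars_vunion => /(guided_lam_aci1 x_in).
Qed.

Lemma guided_fix : {in step_vars l r, forall x,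
  aci1 (tsubst tau (rhs bind lam x)) (tau x)}.
Proof.
move=> x x_in; rewrite guided_rhs; last by rewrite mem_cat x_in orbT.
by rewrite -lambda_var // guided_ext_used //; apply/lr_used/vars_step_vars.
Qed.

Lemma guided_propagated p u : p \in E2 -> u \in propagated lam p ->
  is_app u /\ aci1 (tsubst tau p.1) (tsubst tau u).
Proof.
move=> pE /mem_propagated[u0 [a ap ua]].
have u_app : is_app u.
  case: (propagationP guided_propagation a) => [[_ /(_ p pE)]|la|[q [qE _ la]]].
  - by rewrite ap.
  - by rewrite ua la eqxx in u0.
  - by rewrite ua la; case: (named_binding_app qE).
have [x x_in px] := named_binding_unknown pE.
split=> //.
have [||tau_u] := le_atom (guided_binding_atom pE) (s := tsubst tau u).
- by rewrite ua (guided_lam_aci1 x_in) -?px //; apply: guided_binding_le.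
- have u_atom : is_atom (tsubst tau u) by rewrite /is_atom is_app_tsubst ?orbT.
  by move=> tau_u; case: (atom_le0 u_atom); rewrite tau_u.
- by symmetry.
Qed.

Lemma guided_propagated_head p u : p \in E2 -> u \in propagated lam p ->
  head_sym p.1 = head_sym u.
Proof.
move=> pE up; have [p_app _ _] := guided_binding pE.
have [u_app pu] := guided_propagated pE up.
rewrite -(head_sym_tsubst tau u_app) -(head_sym_tsubst tau p_app).
by apply: aci1_head_sym; rewrite ?is_app_tsubst.
Qed.

Lemma guided_accepted : accepted E2 lam.
Proof.
apply/allP=> p pE; apply/andP; split; last first.
  by apply/allP=> u /(guided_propagated_head pE)->.
rewrite lt0n size_eq0; apply/eqP => prop0.
apply: (atom_le0 (guided_binding_atom pE)).
have [_ -> ->] := guided_binding pE.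
have [x x_in px] := named_binding_unknown pE.
rewrite px -guided_rhs //; apply/(le_rhs_propagated _ _ _ p.1) => u.
by rewrite -px -surjective_pairing prop0.
Qed.

Lemma guided_argument_system : unifier tau (argument_system E2 lam).
Proof.
move=> e /flatten_mapP[p pE /flatten_mapP[u up eu]].
have [p_app _ _] := guided_binding pE; have [_ pu] := guided_propagated pE up.
exact: ((unifier_args tau p_app (guided_propagated_head pE up)).2 pu) eu.
Qed.

Lemma guided_weight_argument e : e \in argument_system E2 lam ->
  weight tau e.1 < weight sigma l.
Proof.
move=> /flatten_mapP[p pE /flatten_mapP[u up /mem_zip[ep _]]].
have [p_app eqp _] := guided_binding pE.
apply: leq_trans (weight_args tau p_app ep) _.
rewrite [weight tau _]/weight eqp; apply: weight_le.
have [+ _] := mem_zip pE.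
rewrite mem_cat => /orP[]; rewrite mem_filter => /andP[_].
  exact: member_tsubst_le.
by rewrite unify_lr; apply: member_tsubst_le.
Qed.

Lemma guided_weight_depends x y :
  depends l r bind lam x y -> y \in step_vars l r ->
  weight tau (Var y) < weight tau (Var x).
Proof.
case/andP=> x_in; rewrite vars_tsubst vars_vunion.
case/flatten_mapP=> a ax ya y_in.
rewrite -(weight_aci1 (t := Var x) (guided_fix x_in)).
apply: leq_trans (weight_le (mem_rhs_le lam tau ax)).
apply: weight_app_var (ya).
have x_unk : x \in unknowns by rewrite mem_cat x_in orbT.
case: (propagationP guided_propagation a) ya => [[-> _]|->|[p [pE _ ->]]] //.
  rewrite inE => /eqP ya; have := bind_fresh es x_unk ax.
  by rewrite -ya lr_used // vars_step_vars.
by case: (named_binding_app pE).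
Qed.

Lemma guided_acyclic : ~ cyclic l r bind lam.
Proof.
case=> x x_in cyc.
have lt_path y z : clos_trans nat (fun x y => depends l r bind lam x y) y z ->
    y \in step_vars l r /\
    (z \in step_vars l r -> weight tau (Var z) < weight tau (Var y)).
  elim=> {y z} [y z yz|y z w _ [y_in zy] _ [z_in wz]].
    by split=> [|z_in]; [case/andP: yz | apply: guided_weight_depends].
  by split=> // /wz lt_wz; apply: ltn_trans lt_wz (zy z_in).
by have [_ /(_ x_in)] := lt_path _ _ cyc; rewrite ltnn.
Qed.

Lemma guided_order : exists xs, removal_order l r bind lam xs.
Proof.
pose ge x y := weight tau (Var y) <= weight tau (Var x).
exists (sort ge (step_vars l r)); split; first by rewrite perm_sort.
have ge_trans : transitive ge by move=> y x z xy yz; apply: leq_trans yz xy.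
have: pairwise ge (sort ge (step_vars l r)).
  rewrite -sorted_pairwise //; apply: sort_sorted => x y.
  exact: leq_total.
apply: (sub_in_pairwise (P := mem (step_vars l r))); last first.
  by apply/allP=> x; rewrite mem_sort.
move=> x y x_in _ le_yx; apply/negP => /guided_weight_depends/(_ x_in).
by rewrite ltnNge [_ <= _]le_yx.
Qed.

End GuidedStep.

(** * Completeness *)

Section Completeness.
Variable S : signature.
Implicit Types (s t u l r : term S) (sigma tau theta : subst S).
Implicit Types (E Es : system S) (e : term S * term S) (st : state S).
Implicit Types U : seq nat.

Lemma aci_step_complete U l r sigma :
    {subset vars l ++ vars r <= U} -> aci1 (tsubst sigma l) (tsubst sigma r) ->
  exists V E1 E2 rho tau,
    [/\ aci_step U l r (Some (V, E1, E2, rho)), {in U, tau =1 sigma},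
        absorbs tau rho, unifier tau E1 /\ unifier tau E2 &
        {in E2, forall e, weight tau e.1 < weight sigma l}].
Proof.
move=> lr_used unify_lr.
have [NL [NR [bind es]]] := elementary_solution_exists U l r.
have [lambda [lname lvar]] := elementary_instance lr_used unify_lr es.
have fix_tau := guided_fix lr_used es lname lvar.
have acyc := guided_acyclic lr_used es lname lvar.
have [xs ord] := guided_order lr_used es lname lvar.
have abs : absorbs (guided_ext U sigma lambda) (composition bind
    (guided_lam l r NL NR bind lambda) xs).
  by apply: absorbs_composition => x; rewrite (perm_mem ord.1); apply: fix_tau.
do 4!eexists; exists (guided_ext U sigma lambda); split.
- apply: aci_done (es) (guided_propagation _ _ _ _ _ _) _ (acyc) (ord).
  exact: (guided_accepted lr_used es lname).
- exact: guided_ext_used.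
- exact: abs.
- split; last first.
    apply/(unifier_subst_sys _ abs).
    exact: (guided_argument_system lr_used es lname).
  by move=> _ /mapP[x x_in ->] /=; rewrite absorbs_tsubst // fix_tau.
- move=> _ /mapP[e eE ->] /=; rewrite (weight_aci1 (absorbs_tsubst _ abs)).
  exact: (guided_weight_argument lr_used unify_lr lname).
Qed.

Definition weights sigma E : seq nat := [seq weight sigma e.1 | e <- E].

Lemma weights_subst_sys sigma theta E :
  absorbs sigma theta -> weights sigma (subst_sys theta E) = weights sigma E.
Proof.
move=> abs; rewrite /weights -map_comp; apply: eq_map => e /=.
exact/weight_aci1/absorbs_tsubst.
Qed.

Lemma eq_weights sigma tau E :
  {in vars_sys E, sigma =1 tau} -> weights sigma E = weights tau E.
Proof.
move=> /eq_subst_sys/(congr1 (map (fun e => depth (fun=> 0) e.1))).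
by rewrite -!map_comp.
Qed.

(* A bound on the number of steps, orienting [e] or extracting its variable from
   the top of the right-hand side, that precede the one removing [e]. *)
Definition preparation e : nat :=
  match e with
  | (Var x, t) => ~~ is_var t && (x \in vars t)
  | (_, Var _) => 2
  | _ => 0
  end.

Definition rank sigma E : seq nat * nat :=
  (weights sigma E, if E is e :: _ then preparation e else 0).

Definition rank_lt : seq nat * nat -> seq nat * nat -> Prop :=
  slexprod _ _ (multiset_ext (fun m n : nat => m < n)) (fun m n => m < n).

Lemma rank_lt_wf : well_founded rank_lt.
Proof. by apply: wf_slexprod; [apply: multiset_ext_wf|]; apply: ltn_wf. Qed.

Lemma rank_lt_weights sigma tau e E E' ds :
    perm_eq (weights tau E') (ds ++ weights sigma E) ->
    {in ds, forall d, d < weight sigma e.1} ->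
  rank_lt (rank tau E') (rank sigma (e :: E)).
Proof.
by move=> pE' lt_ds; left; exists (weight sigma e.1), ds, (weights sigma E).
Qed.

Lemma rank_lt_preparation sigma tau e e' E E' :
    weights tau (e' :: E') = weights sigma (e :: E) ->
    preparation e' < preparation e ->
  rank_lt (rank tau (e' :: E')) (rank sigma (e :: E)).
Proof. by rewrite /rank => -> ?; right. Qed.

Section Progress.
Variables (U : seq nat) (Es E : system S) (sigma : subst S).
Hypothesis usedEs : {subset vars_sys Es <= U}.
Hypothesis usedE : {subset vars_sys E <= U}.

Definition advances e : Prop := exists st tau,
  [/\ act U Es E e (Some st), {in U, tau =1 sigma}, solves tau st &
      rank_lt (rank tau (todo st)) (rank sigma (e :: E))].

Lemma advances_trivial x :
  solves sigma (State U Es ((Var x, Var x) :: E)) -> advances (Var x, Var x).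
Proof.
case=> unEs /unifier_cons[_ unE].
eexists; exists sigma; split; [exact: act_trivial | by [] | by [] |].
exact: (rank_lt_weights (ds := [::])).
Qed.

Lemma advances_orient t x :
    solves sigma (State U Es ((t, Var x) :: E)) -> ~~ is_var t ->
  advances (t, Var x).
Proof.
case=> unEs /unifier_cons[/= un unE] t_nvar.
eexists; exists sigma; split; [exact: act_orient | by [] | |].
  by split=> //; apply/unifier_cons; split=> //; symmetry.
apply: rank_lt_preparation.
  by rewrite /weights /=; congr (_ :: _); apply/esym/weight_aci1.
by rewrite /= t_nvar; case: (t) t_nvar => //= *; case: (_ \in _).
Qed.

Lemma advances_eliminate x t :
    solves sigma (State U Es ((Var x, t) :: E)) -> x \notin vars t ->
  advances (Var x, t).
Proof.
move=> sol xt; have [_ /unifier_cons[/= un _]] := sol.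
eexists; exists sigma; split.
- exact: act_eliminate.
- by [].
- exact/solves_eliminate.
- apply: (rank_lt_weights (ds := [::])) => //=.
  by rewrite weights_subst_sys //; apply: absorbs_subst1.
Qed.

(* Otherwise the value of [x] would be less deep than itself. *)
Lemma unifier_occurs_top x t : aci1 (sigma x) (tsubst sigma t) ->
  x \notin flatten [seq vars u | u <- app_members t].
Proof.
move=> un; apply/negP => /flatten_mapP[u].
rewrite mem_filter => /andP[u_app ut] xu.
have := weight_le (member_tsubst_le sigma ut).
rewrite -(weight_aci1 (s := Var x) un) leqNgt.
by rewrite (weight_app_var sigma u_app xu).
Qed.

(* The new variable takes the value of [x]: it absorbs the other members. *)
Lemma advances_top_occurs x t :
    solves sigma (State U Es ((Var x, t) :: E)) ->
    {subset vars (Var x : term S) ++ vars t <= U} ->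
    ~~ is_var t -> x \in vars t ->
  advances (Var x, t).
Proof.
case=> /= unEs /unifier_cons[/= un unE] used_xt t_nvar xt.
have x_app := unifier_occurs_top un.
have x_mem : x \in var_members t.
  by case: (vars_split xt) => //; rewrite (negPf x_app).
pose n := fresh U; have n_U : n \notin U by apply: notin_ge_fresh.
have xU : x \in U by apply/used_xt/mem_head.
have x_n : x != n by apply: contraNneq n_U => <-.
pose tau y := if y == n then sigma x else sigma y.
have tau_eq : {in U, tau =1 sigma}.
  by move=> y yU; rewrite /tau ifN //; apply: contraNneq n_U => <-.
eexists; exists tau; split; [exact: act_top_occurs x_app n_U | by [] | |].
  split; first exact/(eq_unifier (sub_in1 usedEs tau_eq)).
  apply/unifier_cons; split; last exact/(eq_unifier (sub_in1 usedE tau_eq)).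
  have tau_n : tau n = tau x by rewrite [RHS]tau_eq // /tau eqxx.
  rewrite /= tau_n; symmetry; apply/(top_occurs_aci1 tau x_mem).
  rewrite tau_eq // (tsubst_ext (tau := sigma)) // => y yt.
  by apply/tau_eq/used_xt; rewrite inE yt orbT.
apply: rank_lt_preparation; last first.
  rewrite /= t_nvar xt /= mem_cat inE (negbTE x_n) orbF.
  by rewrite (negbTE (notin_vars_bigU_other x_app)).
rewrite /weights /= -!/(weights _ _) (eq_weights (sub_in1 usedE tau_eq)).
by rewrite /weight /= tau_eq.
Qed.

Lemma unifier_head_sym s t :
    ~~ is_var s -> ~~ is_var t -> ~~ is_union s -> ~~ is_union t ->
    aci1 (tsubst sigma s) (tsubst sigma t) ->
  head_sym s = head_sym t.
Proof.
case: s t => [//||//|f ts] [//||//|g us] //= _ _ _ _ un.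
- case: (@atom_le0 _ (App g [ffun i => tsubst sigma (us i)])) => //.
  by rewrite -un.
- case: (@atom_le0 _ (App f [ffun i => tsubst sigma (ts i)])) => //.
  by rewrite un.
- exact: aci1_head_sym un.
Qed.

Lemma advances_decompose s t :
    solves sigma (State U Es ((s, t) :: E)) ->
    ~~ is_var s -> ~~ is_var t -> ~~ is_union s -> ~~ is_union t ->
  advances (s, t).
Proof.
case=> /= unEs /unifier_cons[/= un unE] s_nvar t_nvar s_nun t_nun.
have heads := unifier_head_sym s_nvar t_nvar s_nun t_nun un.
eexists; exists sigma; split; [exact: act_decompose | by [] | |].
  by split=> //; apply/unifier_cat; split=> //; apply/unifier_decompose.
apply: (rank_lt_weights (ds := weights sigma (zip (args s) (args t)))) => /=.
  by rewrite /weights map_cat.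
move=> _ /mapP[e /mem_zip[e_s _] ->]; apply: weight_args (e_s).
by case: (s) e_s.
Qed.

Lemma advances_union l r :
    solves sigma (State U Es ((l, r) :: E)) ->
    {subset vars l ++ vars r <= U} ->
    ~~ is_var l -> ~~ is_var r -> is_union l || is_union r ->
  advances (l, r).
Proof.
case=> /= unEs /unifier_cons[/= un unE] used_lr l_nvar r_nvar lr_union.
have [V [E1 [E2 [rho [tau]]]]] := aci_step_complete used_lr un.
case=> astep tau_eq abs [un1 un2] lt_l.
eexists; exists tau; split; [exact: act_union astep | by [] | |].
  split; apply/unifier_cat; split=> //; apply/unifier_subst_sys => //.
    exact/(eq_unifier (sub_in1 usedEs tau_eq)).
  exact/(eq_unifier (sub_in1 usedE tau_eq)).
apply: (rank_lt_weights (ds := weights tau E2)) => /=.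
  rewrite /weights map_cat perm_catC -!/(weights _ _) weights_subst_sys //.
  by rewrite (eq_weights (sub_in1 usedE tau_eq)).
by move=> _ /mapP[e eE2 ->]; apply: lt_l.
Qed.

Lemma act_progress e :
    solves sigma (State U Es (e :: E)) -> {subset vars e.1 ++ vars e.2 <= U} ->
  advances e.
Proof.
case: e => s t sol used_st.
have [s_var|s_nvar] := boolP (is_var s).
  case: s s_var sol used_st => // x _ sol used_xt.
  have [xt|xt] := boolP (x \in vars t); last exact: advances_eliminate.
  have [t_var|t_nvar] := boolP (is_var t); last exact: advances_top_occurs.
  case: t t_var xt sol {used_xt} => // y _; rewrite inE => /eqP<-.
  exact: advances_trivial.
have [t_var|t_nvar] := boolP (is_var t).
  by case: t t_var sol {used_st} => // x _ sol; apply: advances_orient.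
have [un_st|/norP[s_nun t_nun]] := boolP (is_union s || is_union t).
  exact: advances_union.
exact: advances_decompose.
Qed.

End Progress.

Definition completable sigma st : Prop :=
  exists Es tau, [/\ branch st Es, {in used st, tau =1 sigma} & unifier tau Es].

Lemma completable_of_solves sigma st :
  invariant st -> solves sigma st -> completable sigma st.
Proof.
move En: (rank sigma (todo st)) => n.
elim: n / (rank_lt_wf n) sigma st En => n _ IH sigma [U Es [|e E]] /=.
  by move=> _ _ [unEs _]; exists Es, sigma; split=> //; constructor.
move=> En inv sol.
have [usedEs used_e usedE] := invariant_used inv.
have [st [tau [step tau_eq sol' lt_rank]]] :=
  act_progress usedEs usedE sol used_e.
have lt_n : rank_lt (rank tau (todo st)) n by rewrite -En.
have [Es' [tau' [br tau'_eq un]]] :=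
  IH _ lt_n tau st erefl (act_invariant step inv) sol'.
exists Es', tau'; split=> //.
  exact: branch_step (step_select (E := [::]) step) br.
by move=> x xU; rewrite tau'_eq ?tau_eq //; apply: (act_used step).
Qed.

End Completeness.

Theorem theorem8p5 (S : signature) (E : system S) :
  (forall Es : system S,
      general_aci E Es -> solved_form Es /\ unifier (subst_of Es) E) /\
  (forall sigma : subst S,
      unifier sigma E ->
      exists2 Es : system S,
        general_aci E Es & more_general (vars_sys E) (subst_of Es) sigma).
Proof.
have inv : invariant (State (vars_sys E) [::] E).
  by exists [::] => //; apply: well_formed_init.
split=> [Es br|sigma un].
  have [sol un] := branch_sound br inv; split=> //.
  by have [] := un _ (solved_form_unifier sol).
have [//|Es [tau [br tau_eq unEs]]] :=
  completable_of_solves (sigma := sigma) inv.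
exists Es => //; exists tau => x xE.
by rewrite -tau_eq // (absorbs_subst_of unEs).
Qed.
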